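(* Let $\mathcal A$ be a unital complex $*$-algebra and let $(\Omega^1_{\mathrm d}(\mathcal A),\dagger,\langle\cdot|\cdot\rangle,\sigma^{\mathrm{can}})$ be a centred Hermitian differential calculus over $\mathcal A$. Let $\overrightarrow\nabla$ be the unique Hermitian torsion-free $\sigma^{\mathrm{can}}$-$\dagger$-bimodule connection on $\Omega^1_{\mathrm d}(\mathcal A)$ (such a connection exists and is unique), and let $\overleftarrow\nabla=-\dagger\circ\overrightarrow\nabla\circ\dagger$. Then, with the induced affine connections on vector fields, $(\overleftarrow{\mathcal X}(\mathcal A),\langle\cdot|\cdot\rangle_{\mathcal A},D_\varphi,\overleftarrow\nabla)$ is a right real pseudo-Riemannian calculus and $(\overrightarrow{\mathcal X}(\mathcal A),{}_{\mathcal A}\langle\cdot|\cdot\rangle,D_\varphi,\overrightarrow\nabla)$ is a left real pseudo-Riemannian calculus, and the inner products are strongly non-degenerate.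
   Context: Throughout $\mathcal A$ is a unital complex $*$-algebra. A $\dagger$-bimodule is an $\mathcal A$-bimodule with an antilinear involution $\dagger$ satisfying $(axb)^\dagger=b^*x^\dagger a^*$. **First-order structure.** A Hermitian first-order differential structure over $\mathcal A$ consists of a $\dagger$-bimodule $\Omega=\Omega^1_{\mathrm d}(\mathcal A)$, a $\mathbb C$-linear derivation $\mathrm d:\mathcal A\to\Omega$ with $\mathrm d(a^* )=-\mathrm d(a)^\dagger$, such that every element of $\Omega$ is a finite sum $\sum a_i\,\mathrm d b_i$, $\Omega$ is finitely generated projective as an $\mathcal A$-module, together with a biadditive map $\langle\cdot|\cdot\rangle_{\mathcal A}:\Omega\times\Omega\to\mathcal A$ with: (1) $\langle\omega|\eta a\rangle=\langle\omega|\eta\rangle a$; (2) $\langle\omega|\eta\rangle^*=\langle\eta|\omega\rangle$; (3) $\langle a\omega|\eta\rangle=\langle\omega|a^*\eta\rangle$; (4) $\omega\mapsto(\eta\mapsto\langle\omega^\dagger|\eta\rangle)$ is an isomorphism of left $\mathcal A$-modules from $\Omega$ onto the right-$\mathcal A$-linear maps $\Omega\to\mathcal A$. The left inner product is ${}_{\mathcal A}\langle\omega|\rho\rangle=\langle\omega^\dagger|\rho^\dagger\rangle_{\mathcal A}$. **Centred calculus.** $T^2_{\mathrm d}(\mathcal A)=\Omega\otimes_{\mathcal A}\Omega$ with $(\omega\otimes\eta)^\dagger=\eta^\dagger\otimes\omega^\dagger$. The centre of a bimodule is $\mathcal Z(\mathcal Y)=\{y:ay=ya\ \forall a\}$; $\mathcal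 Y$ is centred if generated as a bimodule by $\mathcal Z(\mathcal Y)$. If $\Omega$ is centred there is a unique invertible bimodule map $\sigma^{\mathrm{can}}$ on $T^2_{\mathrm d}(\mathcal A)$ with $(\sigma^{\mathrm{can}})^{-1}\circ\dagger=\dagger\circ\sigma^{\mathrm{can}}$ and $\sigma^{\mathrm{can}}(\omega\otimes\eta)=\eta\otimes\omega$ whenever $\omega$ or $\eta$ is central; it is an involution. Put $\Psi=\frac12(1+\sigma^{\mathrm{can}})$, $g(\omega\otimes\eta)=-\langle\omega^\dagger|\eta\rangle_{\mathcal A}$, $JT^2_{\mathrm d}=\{\sum\mathrm d a_i\otimes\mathrm d b_i:\sum a_i\,\mathrm d b_i=0\}$. A centred Hermitian differential calculus is a Hermitian first-order differential structure such that $\Omega$ is centred, $g\circ\sigma^{\mathrm{can}}=g$ and $JT^2_{\mathrm d}\subset\operatorname{Im}\Psi$. Its exterior derivative is $\mathrm d_\Psi:\Omega\to T^2_{\mathrm d}(\mathcal A)$, $\mathrm d_\Psi(\sum a_i\,\mathrm d b_i)=(1-\Psi)(\sum\mathrm d a_i\otimes\mathrm d b_i)$. **Connections on forms.** A right connection is a $\mathbb C$-linear $\overrightarrow\nabla:\Omega\to T^2_{\mathrm d}(\mathcal A)$ with $\overrightarrow\nabla(\omega a)=\overrightarrow\nabla(\omega)a+\omega\otimes\mathrm d a$; its conjugate left connection is $\overleftarrow\nabla=-\dagger\circ\overrightarrow\nabla\circ\dagger$. It is torsion-free if $(1-\Psi)\circ\overrightarrow\nabla+\mathrm d_\Psi=0$;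 Hermitian if $-\langle\overrightarrow\nabla\omega|\eta\rangle_\Omega+\langle\omega|\overrightarrow\nabla\eta\rangle_\Omega=\mathrm d\langle\omega|\eta\rangle_{\mathcal A}$, where $\langle\omega|\eta\otimes\rho\rangle_\Omega=\langle\omega|\eta\rangle_{\mathcal A}\rho$, $\langle\eta\otimes\rho|\omega\rangle_\Omega=\rho^\dagger\langle\eta|\omega\rangle_{\mathcal A}$; a $\sigma^{\mathrm{can}}$-$\dagger$-bimodule connection if $\sigma^{\mathrm{can}}\circ\overrightarrow\nabla=\overleftarrow\nabla$. **Vector fields.** $\overrightarrow{\mathcal X}(\mathcal A)$, $\overleftarrow{\mathcal X}(\mathcal A)$, $\overleftrightarrow{\mathcal X}(\mathcal A)$ are the right-linear, left-linear and bimodule maps $\Omega\to\mathcal A$. $\overrightarrow{\mathcal X}(\mathcal A)$ is a left module via $(aX)(\omega)=aX(\omega)$ and $\overleftarrow{\mathcal X}(\mathcal A)$ a right module via $(Yb)(\omega)=Y(\omega)b$. For $X\in\overrightarrow{\mathcal X}(\mathcal A)$, $Y\in\overleftarrow{\mathcal X}(\mathcal A)$, write $\langle\langle X|\omega\otimes\eta|Y\rangle\rangle=X(\omega)Y(\eta)$, extended additively to $T^2_{\mathrm d}(\mathcal A)$. The musical isomorphisms are $\overrightarrow\sharp:\Omega\to\overrightarrow{\mathcal X}(\mathcal A)$, $\omega\mapsto(\eta\mapsto\langle\omega^\dagger|\eta\rangle_{\mathcal A})$ and $\overleftarrow\sharp:\Omega\to\overleftarrow{\mathcal X}(\mathcal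 A)$, $\omega\mapsto(\eta\mapsto\langle\eta^\dagger|\omega\rangle_{\mathcal A})$, with inverses $\overrightarrow\flat,\overleftarrow\flat$. Inner products: $\langle X|Y\rangle_{\mathcal A}=\langle X^{\overleftarrow\flat}|Y^{\overleftarrow\flat}\rangle_{\mathcal A}$ on $\overleftarrow{\mathcal X}(\mathcal A)$ and ${}_{\mathcal A}\langle U|V\rangle={}_{\mathcal A}\langle U^{\overrightarrow\flat}|V^{\overrightarrow\flat}\rangle$ on $\overrightarrow{\mathcal X}(\mathcal A)$. Strong non-degeneracy of these means that $X\mapsto\langle X|\cdot\rangle_{\mathcal A}$ is a bijection of $\overleftarrow{\mathcal X}(\mathcal A)$ onto its right-linear dual, respectively $V\mapsto{}_{\mathcal A}\langle\cdot|V\rangle$ is a bijection of $\overrightarrow{\mathcal X}(\mathcal A)$ onto its left-linear dual. **Derivations.** $\mathrm{Der}(\mathcal A)$ is the set of $\mathbb C$-linear derivations of $\mathcal A$; $\partial$ is Hermitian if $\partial(a^* )^*=\partial(a)$ for all $a$. $D_{\mathbb C}=\{\partial\in\mathrm{Der}(\mathcal A):\sum a_i\,\mathrm d b_i=0\Rightarrow\sum a_i\partial b_i=0\}$, $D$ is the set of Hermitian elements of $D_{\mathbb C}$, and $\varphi:D_{\mathbb C}\to\overleftrightarrow{\mathcal X}(\mathcal A)$, $\varphi(\partial)(\sum a_i\,\mathrm d b_i)=\sum a_i\partial b_i$; $D_\varphi=(D,\varphi)$. **Induced affine connections.** For $\partial\in D$: $(\overrightarrow\nabla_\partial X)(\omega)=\partial(X(\omega))-\langle\langle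 X|\overrightarrow\nabla(\omega)|\varphi(\partial)\rangle\rangle$ for $X\in\overrightarrow{\mathcal X}(\mathcal A)$, and $(\overleftarrow\nabla_\partial X)(\omega)=\partial(X(\omega))-\langle\langle\varphi(\partial)|\overleftarrow\nabla(\omega)|X\rangle\rangle$ for $X\in\overleftarrow{\mathcal X}(\mathcal A)$. **Calculi.** Data $(\mathcal X,\langle\cdot|\cdot\rangle,\mathfrak g_\varphi,\nabla)$ form a right real pseudo-Riemannian calculus when: $\mathcal X$ is a right $\mathcal A$-module; $\langle\cdot|\cdot\rangle:\mathcal X\times\mathcal X\to\mathcal A$ is biadditive with $\langle X|Ya\rangle=\langle X|Y\rangle a$, $\langle X|Y\rangle^*=\langle Y|X\rangle$, and $\langle X|Y\rangle=0$ for all $Y$ implies $X=0$; $\mathfrak g$ is the real Lie algebra of Hermitian derivations in a complex Lie subalgebra $\mathfrak g_{\mathbb C}\subset\mathrm{Der}(\mathcal A)$, $\varphi:\mathfrak g_{\mathbb C}\to\mathcal X$ is $\mathbb C$-linear, $\mathfrak g_\varphi=(\mathfrak g,\varphi)$; $\varphi(\mathfrak g)$ generates $\mathcal X$ as a right module; $\nabla:\mathfrak g\times\mathcal X\to\mathcal X$ is additive in $X$, real-linear in $\partial$, with $\nabla_\partial(Xa)=(\nabla_\partial X)a+X\partial a$; for $X,Y\in\varphi(\mathfrak g)$ and $\partial,\partial_1,\partial_2\in\mathfrak g$ the elements $\langle X|Y\rangle$, $\langle\nabla_\partial X|Y\rangle$, $\langle\nabla_{\partial_1}\nabla_{\partial_2}X|Y\rangle$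 are self-adjoint; $\partial\langle X|Y\rangle=\langle\nabla_\partial X|Y\rangle+\langle X|\nabla_\partial Y\rangle$ for all $X,Y\in\mathcal X$; and $\nabla_{\partial_1}\varphi(\partial_2)-\nabla_{\partial_2}\varphi(\partial_1)-\varphi([\partial_1,\partial_2])=0$. Left real pseudo-Riemannian calculi are defined analogously for left modules with ${}_{\mathcal A}\langle aX|Y\rangle=a\,{}_{\mathcal A}\langle X|Y\rangle$ and $\nabla_\partial(aX)=a\nabla_\partial X+(\partial a)X$. Here $\mathfrak g_{\mathbb C}=D_{\mathbb C}$, $\mathfrak g=D$. *)

(* Defs.v *)
From HB Require Import structures.
From mathcomp Require Import all_boot all_order all_algebra.
From mathcomp Require Import complex.
From mathcomp Require Import boolp classical_sets functions reals.

Set Implicit Arguments.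
Unset Strict Implicit.
Unset Printing Implicit Defensive.

Import GRing.Theory Num.Theory.

Local Open Scope ring_scope.
Local Open Scope complex_scope.
Local Open Scope quotient_scope.
Local Open Scope classical_set_scope.

HB.mixin Record isStarAlgebra (R : realType) A of GRing.Algebra R[i] A := {
  star : A -> A;
  starD : forall a b : A, star (a + b) = star a + star b;
  starZ : forall (z : R[i]) (a : A), star (z *: a) = conjc z *: star a;
  starM : forall a b : A, star (a * b) = star b * star a;
  starK : involutive star
}.

#[short(type="starAlgType")]
HB.structure Definition StarAlgebra (R : realType) :=
  {A of isStarAlgebra R A & GRing.Algebra R[i] A}.

HB.mixin Record Zmodule_isRmodule (A : pzRingType) M of GRing.Zmodule M := {
  ract : M -> A -> M;
  ractA : forall x a b, ract (ract x a) b = ract x (a * b);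
  ract1 : forall x, ract x 1 = x;
  ractDl : forall x y a, ract (x + y) a = ract x a + ract y a;
  ractDr : forall x a b, ract x (a + b) = ract x a + ract x b
}.

#[short(type="rmodType")]
HB.structure Definition Rmodule (A : pzRingType) :=
  {M of Zmodule_isRmodule A M & GRing.Zmodule M}.

Notation "x :* a" := (ract x a) : ring_scope.

HB.mixin Record Lmodule_Rmodule_isBimodule (A : pzRingType) M
    of GRing.Lmodule A M & Rmodule A M := {
  bimodA : forall (a b : A) (x : M), a *: (x :* b) = (a *: x) :* b
}.

#[short(type="bimodType")]
HB.structure Definition Bimodule (A : pzRingType) :=
  {M of Lmodule_Rmodule_isBimodule A M & GRing.Lmodule A M & Rmodule A M}.

(* The complex vector space structure of a module over the complex algebra A  *)
(* is the one given by the action of the scalars z%:A; on a bimodule the left *)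
(* and right actions of these scalars agree.                                  *)
HB.mixin Record Bimodule_isDaggerBimodule (R : realType) (A : starAlgType R) M
    of Bimodule A M := {
  dag : M -> M;
  bimod_scalar : forall (z : R[i]) (x : M), (z%:A : A) *: x = x :* (z%:A : A);
  dagD : forall x y, dag (x + y) = dag x + dag y;
  dagZ : forall (z : R[i]) (x : M),
    dag ((z%:A : A) *: x) = ((conjc z)%:A : A) *: dag x;
  dagK : involutive dag;
  dag_act : forall (a b : A) (x : M),
    dag ((a *: x) :* b) = (star b *: dag x) :* star a
}.

#[short(type="dagBimodType")]
HB.structure Definition DaggerBimodule (R : realType) (A : starAlgType R) :=
  {M of Bimodule_isDaggerBimodule R A M & Bimodule A M}.

Section RightModuleTheory.
Context {A : pzRingType} {M : rmodType A}.
Implicit Types (x y : M) (a : A).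

Lemma ract0l a : (0 : M) :* a = 0.
Proof. by apply: (addIr ((0 : M) :* a)); rewrite -ractDl !add0r. Qed.

Lemma ract0r x : x :* (0 : A) = 0.
Proof. by apply: (addIr (x :* (0 : A))); rewrite -ractDr !add0r. Qed.

Lemma ractNl x a : (- x) :* a = - (x :* a).
Proof. by apply: (addIr (x :* a)); rewrite -ractDl !addNr ract0l. Qed.

Lemma ractNr x a : x :* (- a) = - (x :* a).
Proof. by apply: (addIr (x :* a)); rewrite -ractDr !addNr ract0r. Qed.

Lemma ract_suml (I : Type) (r : seq I) (P : pred I) (F : I -> M) a :
  (\sum_(i <- r | P i) F i) :* a = \sum_(i <- r | P i) (F i :* a).
Proof.
by elim/big_rec2: _ => [|i u v _ <-]; rewrite ?ract0l ?ractDl.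
Qed.

End RightModuleTheory.

Section LinearMaps.
Variable A : pzRingType.

Definition rmod_hom (M N : rmodType A) (f : M -> N) : Prop :=
  {morph f : x y / x + y} /\ forall x a, f (x :* a) = f x :* a.

Definition finitely_generated (M : rmodType A) : Prop :=
  exists n (x : 'I_n -> M), forall y, exists a : 'I_n -> A,
    y = \sum_i x i :* a i.

Definition projective (M : rmodType A) : Prop :=
  forall (U V : rmodType A) (p : U -> V) (f : M -> V),
    rmod_hom p -> rmod_hom f -> (forall v, exists u, p u = v) ->
  exists h : M -> U, rmod_hom h /\ forall x, p (h x) = f x.

Definition right_linear (M : rmodType A) (f : M -> A) : Prop :=
  {morph f : x y / x + y} /\ forall x a, f (x :* a) = f x * a.

Definition left_linear (M : lmodType A) (f : M -> A) : Prop :=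
  {morph f : x y / x + y} /\ forall a x, f (a *: x) = a * f x.

Definition bimod_hom (M N : bimodType A) (f : M -> N) : Prop :=
  [/\ {morph f : x y / x + y}, forall a x, f (a *: x) = a *: f x
    & forall x a, f (x :* a) = f x :* a].

Definition central (M : bimodType A) (x : M) : Prop :=
  forall a : A, a *: x = x :* a.

Definition centred (M : bimodType A) : Prop :=
  forall y : M, exists n (a b : 'I_n -> A) (x : 'I_n -> M),
    (forall i, central (x i)) /\ y = \sum_i (a i *: x i) :* b i.

End LinearMaps.

(* Tensor product over A of a right and a left A-module: formal sums of pairs *)
(* modulo the congruence generated by biadditivity and A-balancedness.        *)

Section Tensor.
Context {A : pzRingType} (M : rmodType A) (N : lmodType A).

Inductive tens_rel : seq (M * N) -> seq (M * N) -> Prop :=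
| TensRefl s : tens_rel s s
| TensSym s t : tens_rel s t -> tens_rel t s
| TensTrans s t u : tens_rel s t -> tens_rel t u -> tens_rel s u
| TensCat s s' t t' :
    tens_rel s s' -> tens_rel t t' -> tens_rel (s ++ t) (s' ++ t')
| TensC s t : tens_rel (s ++ t) (t ++ s)
| Tens0 y : tens_rel [:: (0, y)] [::]
| TensDl x x' y : tens_rel [:: (x + x', y)] [:: (x, y); (x', y)]
| TensDr x y y' : tens_rel [:: (x, y + y')] [:: (x, y); (x, y')]
| TensA x a y : tens_rel [:: (x :* a, y)] [:: (x, a *: y)].

Definition tens_eq : rel (seq (M * N)) := fun s t => `[< tens_rel s t >].

Lemma tens_eq_refl : reflexive tens_eq.
Proof. by move=> s; apply/asboolP/TensRefl. Qed.

Lemma tens_eq_sym : symmetric tens_eq.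
Proof. by move=> s t; apply/asboolP/asboolP; apply: TensSym. Qed.

Lemma tens_eq_trans : transitive tens_eq.
Proof. by move=> t s u /asboolP st /asboolP tu; apply/asboolP/(TensTrans st). Qed.

Canonical tens_equiv :=
  EquivRel tens_eq tens_eq_refl tens_eq_sym tens_eq_trans.

Definition tens : Type := {eq_quot tens_eq}.
HB.instance Definition _ := Choice.on tens.
HB.instance Definition _ := EqQuotient.on tens.

Lemma tens_eqP s t : reflect (tens_rel s t) (\pi_tens s == \pi_tens t).
Proof. by rewrite eqmodE; apply: asboolP. Qed.

Lemma tens_repr s : tens_rel (repr (\pi_tens s)) s.
Proof. by apply/tens_eqP; rewrite reprK. Qed.

Definition tens_zero : tens := \pi_tens [::].
Definition tens_add (t u : tens) : tens := \pi_tens (repr t ++ repr u).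
Definition tens_opp (t : tens) : tens :=
  \pi_tens [seq (- p.1, p.2) | p <- repr t].

Lemma tens_addE s t : tens_add (\pi_tens s) (\pi_tens t) = \pi_tens (s ++ t).
Proof. by apply/eqP/tens_eqP/TensCat; apply: tens_repr. Qed.

Lemma tens_addA : associative tens_add.
Proof.
elim/quotW=> s; elim/quotW=> t; elim/quotW=> u.
by rewrite (tens_addE t u) (tens_addE s t) !tens_addE catA.
Qed.

Lemma tens_addC : commutative tens_add.
Proof.
elim/quotW=> s; elim/quotW=> t; rewrite (tens_addE s t) (tens_addE t s).
exact/eqP/tens_eqP/TensC.
Qed.

Lemma tens_add0 : left_id tens_zero tens_add.
Proof. by elim/quotW=> s; rewrite (tens_addE [::] s). Qed.

Lemma tens_addN : left_inverse tens_zero tens_opp tens_add.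
Proof.
move=> t; rewrite -{2}[t]reprK (tens_addE _ (repr t)); apply/eqP/tens_eqP.
elim: (repr t) => [|[x y] s IHs] /=; first exact: TensRefl.
set s' := [seq (- p.1, p.2) | p <- s] in IHs *.
apply: (@TensTrans _ ([:: (- x, y); (x, y)] ++ (s' ++ s))).
  apply: (@TensCat [:: (- x, y)] [:: (- x, y)] (s' ++ (x, y) :: s)
            ((x, y) :: s' ++ s)); first exact: TensRefl.
  have := TensCat (TensC s' [:: (x, y)]) (TensRefl s).
  by rewrite -!catA.
apply: (@TensCat _ [::] _ [::]) => //.
by apply: TensTrans (TensSym (TensDl _ _ _)) _; rewrite addNr; apply: Tens0.
Qed.

HB.instance Definition _ :=
  GRing.isZmodule.Build tens tens_addA tens_addC tens_add0 tens_addN.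

Definition tensp (x : M) (y : N) : tens := \pi_tens [:: (x, y)].

Lemma tenspDl x x' y : tensp (x + x') y = tensp x y + tensp x' y.
Proof. by rewrite [RHS]tens_addE; apply/eqP/tens_eqP/TensDl. Qed.

Lemma tenspDr x y y' : tensp x (y + y') = tensp x y + tensp x y'.
Proof. by rewrite [RHS]tens_addE; apply/eqP/tens_eqP/TensDr. Qed.

Lemma tens0p y : tensp 0 y = 0.
Proof. by apply: (addIr (tensp 0 y)); rewrite -tenspDl !add0r. Qed.

Lemma tenspNl x y : tensp (- x) y = - tensp x y.
Proof. by apply: (addIr (tensp x y)); rewrite -tenspDl !addNr tens0p. Qed.

Lemma tenspA x a y : tensp (x :* a) y = tensp x (a *: y).
Proof. exact/eqP/tens_eqP/TensA. Qed.

Lemma tens_sumE s : \pi_tens s = \sum_(p <- s) tensp p.1 p.2.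
Proof.
elim: s => [|[x y] s IHs]; first by rewrite big_nil.
by rewrite big_cons -IHs /= [RHS]tens_addE.
Qed.

Lemma tens_ind (P : tens -> Prop) :
  P 0 -> (forall t u, P t -> P u -> P (t + u)) ->
  (forall x y, P (tensp x y)) -> forall t, P t.
Proof.
move=> P0 PD Pp t; rewrite -[t]reprK tens_sumE.
by elim/big_ind: _ => // p _; apply: Pp.
Qed.

Definition balanced (V : zmodType) (f : M -> N -> V) : Prop :=
  [/\ forall x x' y, f (x + x') y = f x y + f x' y,
      forall x y y', f x (y + y') = f x y + f x y'
    & forall x a y, f (x :* a) y = f x (a *: y)].

(* Meaningful for balanced f only; see tens_liftE and tens_liftD. *)
Definition tens_lift (V : zmodType) (f : M -> N -> V) (t : tens) : V :=
  \sum_(p <- repr t) f p.1 p.2.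

Section Lift.
Variables (V : zmodType) (f : M -> N -> V).
Hypothesis f_bal : balanced f.

Lemma tens_lift_pi s : tens_lift f (\pi_tens s) = \sum_(p <- s) f p.1 p.2.
Proof.
case: f_bal => fDl fDr fA.
rewrite /tens_lift; have: tens_rel (repr (\pi_tens s)) s := tens_repr s.
move: (repr _) => r; elim: r s / => //.
- by move=> s1 s2 s3 _ -> _ ->.
- by move=> s1 s1' s2 s2' _ IH1 _ IH2; rewrite !big_cat /= IH1 IH2.
- by move=> s1 s2; rewrite !big_cat /= addrC.
- move=> y; rewrite big_seq1 big_nil /=; apply: (addIr (f 0 y)).
  by rewrite -fDl !add0r.
- by move=> x x' y; rewrite big_seq1 big_cons big_seq1 /= fDl.
- by move=> x y y'; rewrite big_seq1 big_cons big_seq1 /= fDr.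
- by move=> x a y; rewrite !big_seq1 /= fA.
Qed.

Lemma tens_liftE x y : tens_lift f (tensp x y) = f x y.
Proof. by rewrite tens_lift_pi big_seq1. Qed.

Lemma tens_liftD : {morph tens_lift f : t u / t + u}.
Proof.
move=> t u; rewrite -[t]reprK -[u]reprK.
by rewrite [X in tens_lift f X]tens_addE !tens_lift_pi big_cat.
Qed.

Lemma tens_lift0 : tens_lift f 0 = 0.
Proof. by rewrite [LHS]tens_lift_pi big_nil. Qed.

Lemma tens_liftN : {morph tens_lift f : t / - t}.
Proof.
by move=> t; apply: (addIr (tens_lift f t)); rewrite -tens_liftD !addNr tens_lift0.
Qed.

End Lift.

End Tensor.

Notation "x *t y" := (tensp x y) (at level 40, left associativity) : ring_scope.

Section TensorBimodule.
Context {A : pzRingType} (M N : bimodType A).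

Definition tens_lact (a : A) : tens M N -> tens M N :=
  tens_lift (fun x y => (a *: x) *t y).
Definition tens_ract (t : tens M N) (a : A) : tens M N :=
  tens_lift (fun x y => x *t (y :* a)) t.

Lemma tens_lact_bal a : balanced (fun (x : M) (y : N) => (a *: x) *t y).
Proof.
split=> [x x' y|x y y'|x b y]; first by rewrite scalerDr tenspDl.
  exact: tenspDr.
by rewrite bimodA tenspA.
Qed.

Lemma tens_ract_bal a : balanced (fun (x : M) (y : N) => x *t (y :* a)).
Proof.
split=> [x x' y|x y y'|x b y]; first exact: tenspDl.
  by rewrite ractDl tenspDr.
by rewrite -bimodA tenspA.
Qed.

Lemma tens_lactA a b t : tens_lact a (tens_lact b t) = tens_lact (a * b) t.
Proof.
have bal := tens_lact_bal; rewrite /tens_lact.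
elim/(@tens_ind A M N): t => [|t u IHt IHu|x y]; first by rewrite !tens_lift0.
  by rewrite !tens_liftD // IHt IHu.
by rewrite !tens_liftE // scalerA.
Qed.

Lemma tens_lact1 : left_id 1 tens_lact.
Proof.
have bal := tens_lact_bal; rewrite /tens_lact => t.
elim/(@tens_ind A M N): t => [|t u IHt IHu|x y]; first by rewrite tens_lift0.
  by rewrite tens_liftD // IHt IHu.
by rewrite tens_liftE // scale1r.
Qed.

Lemma tens_lactDr : right_distributive tens_lact +%R.
Proof. by move=> a t u; apply/tens_liftD/tens_lact_bal. Qed.

Lemma tens_lactDl t : {morph tens_lact^~ t : a b / a + b}.
Proof.
have bal := tens_lact_bal; rewrite /tens_lact => a b /=.
elim/(@tens_ind A M N): t => [|t u IHt IHu|x y]; first by rewrite !tens_lift0 // addr0.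
  by rewrite !tens_liftD // IHt IHu addrACA.
by rewrite !tens_liftE // scalerDl tenspDl.
Qed.

HB.instance Definition _ := GRing.Zmodule_isLmodule.Build A (tens M N)
  tens_lactA tens_lact1 tens_lactDr tens_lactDl.

Lemma tens_ractA t a b : tens_ract (tens_ract t a) b = tens_ract t (a * b).
Proof.
have bal := tens_ract_bal; rewrite /tens_ract.
elim/(@tens_ind A M N): t => [|t u IHt IHu|x y]; first by rewrite !tens_lift0.
  by rewrite !tens_liftD // IHt IHu.
by rewrite !tens_liftE // ractA.
Qed.

Lemma tens_ract1 t : tens_ract t 1 = t.
Proof.
have bal := tens_ract_bal; rewrite /tens_ract.
elim/(@tens_ind A M N): t => [|t u IHt IHu|x y]; first by rewrite tens_lift0.
  by rewrite tens_liftD // IHt IHu.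
by rewrite tens_liftE // ract1.
Qed.

Lemma tens_ractDl t u a : tens_ract (t + u) a = tens_ract t a + tens_ract u a.
Proof. exact/tens_liftD/tens_ract_bal. Qed.

Lemma tens_ractDr t a b : tens_ract t (a + b) = tens_ract t a + tens_ract t b.
Proof.
have bal := tens_ract_bal; rewrite /tens_ract.
elim/(@tens_ind A M N): t => [|t u IHt IHu|x y]; first by rewrite !tens_lift0 // addr0.
  by rewrite !tens_liftD // IHt IHu addrACA.
by rewrite !tens_liftE // ractDr tenspDr.
Qed.

HB.instance Definition _ := Zmodule_isRmodule.Build A (tens M N)
  tens_ractA tens_ract1 tens_ractDl tens_ractDr.

Lemma tens_lactE a x y : a *: (x *t y : tens M N) = (a *: x) *t y.
Proof. exact/tens_liftE/tens_lact_bal. Qed.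

Lemma tens_ractE a x y : (x *t y : tens M N) :* a = x *t (y :* a).
Proof. exact/tens_liftE/tens_ract_bal. Qed.

Lemma tens_bimodA (a b : A) (t : tens M N) : a *: (t :* b) = (a *: t) :* b.
Proof.
elim/(@tens_ind A M N): t => [|t u IHt IHu|x y].
- by rewrite ract0l scaler0 ract0l.
- by rewrite ractDl !scalerDr ractDl IHt IHu.
- by rewrite tens_ractE !tens_lactE tens_ractE.
Qed.

HB.instance Definition _ :=
  Lmodule_Rmodule_isBimodule.Build A (tens M N) tens_bimodA.

End TensorBimodule.

Section TensorDagger.
Context {R : realType} {A : starAlgType R} (M : dagBimodType A).

Definition tdag : tens M M -> tens M M := tens_lift (fun x y => dag y *t dag x).

Lemma star1 : star (1 : A) = 1.
Proof. by rewrite -[LHS]mulr1 -{2}[1]starK -starM mulr1 starK. Qed.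

Lemma dagZl (a : A) (x : M) : dag (a *: x) = dag x :* star a.
Proof. by rewrite -[a *: x]ract1 dag_act star1 scale1r.
Qed.

Lemma dag0 : dag (0 : M) = 0.
Proof. by apply: (addIr (dag (0 : M))); rewrite -dagD !add0r. Qed.

Lemma dagN (x : M) : dag (- x) = - dag x.
Proof. by apply: (addIr (dag x)); rewrite -dagD !addNr dag0. Qed.

Lemma dagZr (x : M) (a : A) : dag (x :* a) = star a *: dag x.
Proof. by rewrite -[x in LHS]scale1r dag_act star1 ract1.
Qed.

Lemma tdag_bal : balanced (fun x y : M => dag y *t dag x).
Proof.
split=> [x x' y|x y y'|x a y]; rewrite ?dagD ?tenspDl ?tenspDr //.
by rewrite dagZl dagZr tenspA.
Qed.

Lemma tdagE x y : tdag (x *t y) = dag y *t dag x.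
Proof. exact/tens_liftE/tdag_bal. Qed.

Lemma tdagD : {morph tdag : t u / t + u}.
Proof. exact/tens_liftD/tdag_bal. Qed.

Lemma tdag0 : tdag 0 = 0.
Proof. exact/tens_lift0/tdag_bal. Qed.

Lemma tdagZr t (a : A) : tdag (t :* a) = star a *: tdag t.
Proof.
elim/(@tens_ind A M M): t => [|t u IHt IHu|x y].
- by rewrite ract0l tdag0 scaler0.
- by rewrite ractDl !tdagD IHt IHu scalerDr.
- by rewrite tens_ractE !tdagE dagZr tens_lactE.
Qed.

End TensorDagger.

Section RightDual.
Context {A : pzRingType} (M : rmodType A).

Record rvf := RVF {rvf_fun :> M -> A; _ : `[< right_linear rvf_fun >]}.

HB.instance Definition _ := [isSub for rvf_fun].
HB.instance Definition _ := [Choice of rvf by <:].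

Lemma rvf_closed : zmod_closed (fun f : M -> A => `[< right_linear f >]).
Proof.
split=> [|f g /asboolP[fD fZ] /asboolP[gD gZ]]; apply/asboolP; split.
- by move=> x y; rewrite /= addr0.
- by move=> x a; rewrite mul0r.
- by move=> x y; rewrite !fctE fD gD opprD addrACA.
- by move=> x a; rewrite !fctE fZ gZ mulrBl.
Qed.

HB.instance Definition _ := GRing.SubChoice_isSubZmodule.Build
  (M -> A) _ rvf rvf_closed.

Lemma rvf_linear (X : rvf) : right_linear X.
Proof. by case: X => f /= /asboolP. Qed.

Lemma rvf_scale_subproof (a : A) (X : rvf) :
  `[< right_linear (fun x => a * X x) >].
Proof.
have [XD XZ] := rvf_linear X; apply/asboolP; split.
  by move=> x y; rewrite XD mulrDr.
by move=> x b; rewrite XZ mulrA.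
Qed.

Definition rvf_scale a X := RVF (rvf_scale_subproof a X).

Lemma rvf_scaleA a b X : rvf_scale a (rvf_scale b X) = rvf_scale (a * b) X.
Proof. by apply/val_inj/funext => x /=; rewrite mulrA. Qed.
Lemma rvf_scale1 : left_id 1 rvf_scale.
Proof. by move=> X; apply/val_inj/funext => x /=; rewrite mul1r. Qed.
Lemma rvf_scaleDr : right_distributive rvf_scale +%R.
Proof. by move=> a X Y; apply/val_inj/funext => x; apply: mulrDr. Qed.
Lemma rvf_scaleDl X : {morph rvf_scale^~ X : a b / a + b}.
Proof. by move=> a b; apply/val_inj/funext => x; apply: mulrDl. Qed.

HB.instance Definition _ := GRing.Zmodule_isLmodule.Build A rvf
  rvf_scaleA rvf_scale1 rvf_scaleDr rvf_scaleDl.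

End RightDual.

Section LeftDual.
Context {A : pzRingType} (M : lmodType A).

Record lvf := LVF {lvf_fun :> M -> A; _ : `[< left_linear lvf_fun >]}.

HB.instance Definition _ := [isSub for lvf_fun].
HB.instance Definition _ := [Choice of lvf by <:].

Lemma lvf_closed : zmod_closed (fun f : M -> A => `[< left_linear f >]).
Proof.
split=> [|f g /asboolP[fD fZ] /asboolP[gD gZ]]; apply/asboolP; split.
- by move=> x y; rewrite /= addr0.
- by move=> a x; rewrite mulr0.
- by move=> x y; rewrite !fctE fD gD opprD addrACA.
- by move=> a x; rewrite !fctE fZ gZ mulrBr.
Qed.

HB.instance Definition _ := GRing.SubChoice_isSubZmodule.Build
  (M -> A) _ lvf lvf_closed.

Lemma lvf_linear (X : lvf) : left_linear X.
Proof. by case: X => f /= /asboolP. Qed.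

Lemma lvf_act_subproof (X : lvf) (b : A) :
  `[< left_linear (fun x => X x * b) >].
Proof.
have [XD XZ] := lvf_linear X; apply/asboolP; split.
  by move=> x y; rewrite XD mulrDl.
by move=> a x; rewrite XZ mulrA.
Qed.

Definition lvf_act X b := LVF (lvf_act_subproof X b).

Lemma lvf_actA X a b : lvf_act (lvf_act X a) b = lvf_act X (a * b).
Proof. by apply/val_inj/funext => x /=; rewrite mulrA. Qed.
Lemma lvf_act1 X : lvf_act X 1 = X.
Proof. by apply/val_inj/funext => x /=; rewrite mulr1. Qed.
Lemma lvf_actDl X Y a : lvf_act (X + Y) a = lvf_act X a + lvf_act Y a.
Proof. by apply/val_inj/funext => x; apply: mulrDl. Qed.
Lemma lvf_actDr X a b : lvf_act X (a + b) = lvf_act X a + lvf_act X b.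
Proof. by apply/val_inj/funext => x; apply: mulrDr. Qed.

HB.instance Definition _ := Zmodule_isRmodule.Build A lvf
  lvf_actA lvf_act1 lvf_actDl lvf_actDr.

End LeftDual.

Section TwoSidedDual.
Context {A : pzRingType} (M : bimodType A).

Definition two_sided_linear (f : M -> A) : Prop := left_linear f /\ right_linear f.

Record bvf := BVF {bvf_fun :> M -> A; _ : `[< two_sided_linear bvf_fun >]}.

HB.instance Definition _ := [isSub for bvf_fun].

Lemma bvf_linear (X : bvf) : two_sided_linear X.
Proof. by case: X => f /= /asboolP. Qed.

Lemma bvf0_subproof : `[< two_sided_linear (fun _ => 0) >].
Proof.
apply/asboolP; split; split.
- by move=> x y; rewrite addr0.
- by move=> a x; rewrite mulr0.
- by move=> x y; rewrite addr0.
- by move=> x a; rewrite mul0r.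
Qed.

Definition bvf0 : bvf := BVF bvf0_subproof.

Definition bvf_left (X : bvf) : lvf M := LVF (asboolT (bvf_linear X).1).
Definition bvf_right (X : bvf) : rvf M := RVF (asboolT (bvf_linear X).2).

End TwoSidedDual.

Section Calculi.
Context {R : realType} {A : starAlgType R}.
Implicit Types (del : A -> A).

Definition is_derivation del : Prop :=
  [/\ forall a b, del (a + b) = del a + del b,
      forall (z : R[i]) a, del (z *: a) = z *: del a
    & forall a b, del (a * b) = del a * b + a * del b].

Definition hermitian_der del : Prop := forall a, star (del (star a)) = del a.

Definition lie_bracket del1 del2 : A -> A :=
  fun a => del1 (del2 a) - del2 (del1 a).

Definition complex_lie_subalgebra (gC : set (A -> A)) : Prop :=
  [/\ forall del, gC del -> is_derivation del,
      gC (fun=> 0),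
      forall del1 del2, gC del1 -> gC del2 -> gC (fun a => del1 a + del2 a),
      forall (z : R[i]) del, gC del -> gC (fun a => z *: del a)
    & forall del1 del2, gC del1 -> gC del2 -> gC (lie_bracket del1 del2)].

Definition hermitian_part (gC : set (A -> A)) : set (A -> A) :=
  [set del | gC del /\ hermitian_der del].

Definition selfadjoint (a : A) : Prop := star a = a.

Section Right.
Variables (X : rmodType A) (h : X -> X -> A) (gC : set (A -> A)).
Variables (phi : (A -> A) -> X) (nabla : (A -> A) -> X -> X).

(* phi and nabla are only constrained on gC, resp. on its Hermitian part g.   *)
Record right_rprc : Prop := RightRPRC {
  rprc_hDl : forall U V W, h (U + V) W = h U W + h V W;
  rprc_hDr : forall U V W, h U (V + W) = h U V + h U W;
  rprc_hZ : forall U V a, h U (V :* a) = h U V * a;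
  rprc_hS : forall U V, star (h U V) = h V U;
  rprc_nondeg : forall U, (forall V, h U V = 0) -> U = 0;
  rprc_lie : complex_lie_subalgebra gC;
  rprc_phiD : forall del1 del2, gC del1 -> gC del2 ->
    phi (fun a => del1 a + del2 a) = phi del1 + phi del2;
  rprc_phiZ : forall (z : R[i]) del, gC del ->
    phi (fun a => z *: del a) = phi del :* z%:A;
  rprc_gen : forall U, exists n (del : 'I_n -> A -> A) (a : 'I_n -> A),
    (forall i, hermitian_part gC (del i)) /\ U = \sum_i phi (del i) :* a i;
  rprc_nablaDr : forall del U V, hermitian_part gC del ->
    nabla del (U + V) = nabla del U + nabla del V;
  rprc_nablaDl : forall del1 del2 U,
    hermitian_part gC del1 -> hermitian_part gC del2 ->
    nabla (fun a => del1 a + del2 a) U = nabla del1 U + nabla del2 U;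
  rprc_nablaZl : forall (r : R) del U, hermitian_part gC del ->
    nabla (fun a => r%:C *: del a) U = nabla del U :* (r%:C)%:A;
  rprc_leibniz : forall del U a, hermitian_part gC del ->
    nabla del (U :* a) = nabla del U :* a + U :* del a;
  rprc_real0 : forall d1 d2, hermitian_part gC d1 -> hermitian_part gC d2 ->
    selfadjoint (h (phi d1) (phi d2));
  rprc_real1 : forall del d1 d2, hermitian_part gC del ->
    hermitian_part gC d1 -> hermitian_part gC d2 ->
    selfadjoint (h (nabla del (phi d1)) (phi d2));
  rprc_real2 : forall del1 del2 d1 d2,
    hermitian_part gC del1 -> hermitian_part gC del2 ->
    hermitian_part gC d1 -> hermitian_part gC d2 ->
    selfadjoint (h (nabla del1 (nabla del2 (phi d1))) (phi d2));
  rprc_metric : forall del U V, hermitian_part gC del ->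
    del (h U V) = h (nabla del U) V + h U (nabla del V);
  rprc_torsion : forall del1 del2,
    hermitian_part gC del1 -> hermitian_part gC del2 ->
    nabla del1 (phi del2) - nabla del2 (phi del1)
      - phi (lie_bracket del1 del2) = 0
}.

Definition strongly_nondegenerate_right : Prop :=
  (forall U, right_linear (h U)) /\
  forall f : X -> A, right_linear f -> exists! U, h U = f.

End Right.

Section Left.
Variables (X : lmodType A) (h : X -> X -> A) (gC : set (A -> A)).
Variables (phi : (A -> A) -> X) (nabla : (A -> A) -> X -> X).

Record left_rprc : Prop := LeftRPRC {
  lprc_hDl : forall U V W, h (U + V) W = h U W + h V W;
  lprc_hDr : forall U V W, h U (V + W) = h U V + h U W;
  lprc_hZ : forall a U V, h (a *: U) V = a * h U V;
  lprc_hS : forall U V, star (h U V) = h V U;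
  lprc_nondeg : forall U, (forall V, h U V = 0) -> U = 0;
  lprc_lie : complex_lie_subalgebra gC;
  lprc_phiD : forall del1 del2, gC del1 -> gC del2 ->
    phi (fun a => del1 a + del2 a) = phi del1 + phi del2;
  lprc_phiZ : forall (z : R[i]) del, gC del ->
    phi (fun a => z *: del a) = (z%:A : A) *: phi del;
  lprc_gen : forall U, exists n (del : 'I_n -> A -> A) (a : 'I_n -> A),
    (forall i, hermitian_part gC (del i)) /\ U = \sum_i a i *: phi (del i);
  lprc_nablaDr : forall del U V, hermitian_part gC del ->
    nabla del (U + V) = nabla del U + nabla del V;
  lprc_nablaDl : forall del1 del2 U,
    hermitian_part gC del1 -> hermitian_part gC del2 ->
    nabla (fun a => del1 a + del2 a) U = nabla del1 U + nabla del2 U;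
  lprc_nablaZl : forall (r : R) del U, hermitian_part gC del ->
    nabla (fun a => r%:C *: del a) U = ((r%:C)%:A : A) *: nabla del U;
  lprc_leibniz : forall del a U, hermitian_part gC del ->
    nabla del (a *: U) = a *: nabla del U + del a *: U;
  lprc_real0 : forall d1 d2, hermitian_part gC d1 -> hermitian_part gC d2 ->
    selfadjoint (h (phi d1) (phi d2));
  lprc_real1 : forall del d1 d2, hermitian_part gC del ->
    hermitian_part gC d1 -> hermitian_part gC d2 ->
    selfadjoint (h (nabla del (phi d1)) (phi d2));
  lprc_real2 : forall del1 del2 d1 d2,
    hermitian_part gC del1 -> hermitian_part gC del2 ->
    hermitian_part gC d1 -> hermitian_part gC d2 ->
    selfadjoint (h (nabla del1 (nabla del2 (phi d1))) (phi d2));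
  lprc_metric : forall del U V, hermitian_part gC del ->
    del (h U V) = h (nabla del U) V + h U (nabla del V);
  lprc_torsion : forall del1 del2,
    hermitian_part gC del1 -> hermitian_part gC del2 ->
    nabla del1 (phi del2) - nabla del2 (phi del1)
      - phi (lie_bracket del1 del2) = 0
}.

Definition strongly_nondegenerate_left : Prop :=
  (forall V, left_linear (h^~ V)) /\
  forall f : X -> A, left_linear f -> exists! V, h^~ V = f.

End Left.

End Calculi.

(* Finite generation and projectivity are those of the right module; dag makes *)
(* the right and left versions equivalent.                                     *)
Record hermFirstOrder (R : realType) (A : starAlgType R) := HermFirstOrder {
  forms :> dagBimodType A;
  dd : A -> forms;
  hip : forms -> forms -> A;
  ddD : forall a b, dd (a + b) = dd a + dd b;
  ddZ : forall (z : R[i]) a, dd (z *: a) = (z%:A : A) *: dd a;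
  ddM : forall a b, dd (a * b) = dd a :* b + a *: dd b;
  dd_star : forall a, dd (star a) = - dag (dd a);
  dd_span : forall w : forms, exists s : seq (A * A),
    \sum_(p <- s) p.1 *: dd p.2 = w;
  forms_fg : finitely_generated forms;
  forms_proj : projective forms;
  hipDl : forall u v w, hip (u + v) w = hip u w + hip v w;
  hipDr : forall u v w, hip u (v + w) = hip u v + hip u w;
  hipZ : forall u v a, hip u (v :* a) = hip u v * a;
  hipS : forall u v, star (hip u v) = hip v u;
  hip_act : forall a u v, hip (a *: u) v = hip u (star a *: v);
  hip_sharpZ : forall a u v, hip (dag (a *: u)) v = a * hip (dag u) v;
  hip_iso : forall f : forms -> A, right_linear f ->
    exists! u, (fun v => hip (dag u) v) = f
}.

Section FirstOrder.
Context {R : realType} {A : starAlgType R} (Om : hermFirstOrder A).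

Definition T2 : bimodType A := tens Om Om.

Definition form_sum (s : seq (A * A)) : Om := \sum_(p <- s) p.1 *: dd Om p.2.
Definition dform_sum (s : seq (A * A)) : T2 :=
  \sum_(p <- s) dd Om p.1 *t dd Om p.2.

Lemma form_sum_act a s :
  a *: form_sum s = form_sum [seq (a * p.1, p.2) | p <- s].
Proof.
rewrite /form_sum scaler_sumr big_map; apply: eq_bigr => p _ /=.
by rewrite scalerA.
Qed.

Lemma form_sum_ract s a : form_sum s :* a =
  form_sum ([seq (p.1, p.2 * a) | p <- s] ++
               [seq (- (p.1 * p.2), a) | p <- s]).
Proof.
rewrite /form_sum big_cat !big_map /= ract_suml -big_split /=.
apply: eq_bigr => p _ /=.
by rewrite ddM scalerDr scalerA scaleNr addrK bimodA.
Qed.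

Lemma form_sumN s : - form_sum s = form_sum [seq (- p.1, p.2) | p <- s].
Proof.
rewrite /form_sum -sumrN big_map; apply: eq_bigr => p _ /=.
by rewrite scaleNr.
Qed.

Lemma form_sum_cat s t : form_sum (s ++ t) = form_sum s + form_sum t.
Proof. by rewrite /form_sum big_cat. Qed.

Lemma dform_sum_cat s t : dform_sum (s ++ t) = dform_sum s + dform_sum t.
Proof. by rewrite /dform_sum big_cat. Qed.

Lemma ddN a : dd Om (- a) = - dd Om a.
Proof. by rewrite -[in LHS]scaleN1r ddZ scaleN1r scaleN1r. Qed.

Lemma dform_sumN s : - dform_sum s = dform_sum [seq (- p.1, p.2) | p <- s].
Proof.
rewrite /dform_sum -sumrN big_map; apply: eq_bigr => p _ /=.
by rewrite ddN tenspNl.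
Qed.

Definition form_rep (w : Om) : seq (A * A) := sval (cid (dd_span w)).

Lemma form_repK w : form_sum (form_rep w) = w.
Proof. by rewrite /form_rep; case: cid. Qed.

Definition metric_map : T2 -> A := tens_lift (fun u v : Om => - hip (dag u) v).

Definition is_sigma_can (sigma : T2 -> T2) : Prop :=
  [/\ bimod_hom sigma,
      exists tau : T2 -> T2, [/\ cancel sigma tau, cancel tau sigma
        & forall t, tau (tdag t) = tdag (sigma t)]
    & forall u v : Om, central u \/ central v -> sigma (u *t v) = v *t u].

Definition psi_of (sigma : T2 -> T2) (t : T2) : T2 :=
  (((2%:R)^-1 : R[i])%:A : A) *: (t + sigma t).

End FirstOrder.

Record centredCalculus (R : realType) (A : starAlgType R) := CentredCalculus {
  first_order :> hermFirstOrder A;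
  forms_centred : centred first_order;
  sigma : T2 first_order -> T2 first_order;
  sigma_can : is_sigma_can sigma;
  metric_sigma : forall t, metric_map (sigma t) = metric_map t;
  JT2_sub : forall s : seq (A * A), form_sum first_order s = 0 ->
    exists t, psi_of sigma t = dform_sum first_order s
}.

Section CentredCalculus.
Context {R : realType} {A : starAlgType R} (Om : centredCalculus A).

Notation T2 := (T2 Om).

Definition Psi : T2 -> T2 := psi_of (sigma (c := Om)).

(* Independent of the choice of form_rep, by dPsiE. *)
Definition dPsi (w : Om) : T2 :=
  dform_sum Om (form_rep w) - Psi (dform_sum Om (form_rep w)).

Lemma sigmaD t u : sigma (c := Om) (t + u) = sigma t + sigma u.
Proof. by case: (sigma_can Om) => -[sD _ _] _ _; apply: sD. Qed.

Lemma sigmaK : involutive (sigma (c := Om)).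
Proof.
have [[_ sl sr] _ sE] := sigma_can Om.
have s0 : sigma (c := Om) 0 = 0.
  by apply: (addIr (sigma (c := Om) 0)); rewrite -sigmaD !add0r.
move=> t; elim/(@tens_ind A Om Om): t => [|t u IHt IHu|x y].
- by rewrite !s0.
- by rewrite !sigmaD IHt IHu.
have [n [a [b [z [zc ->]]]]] := forms_centred x.
elim/big_rec: _ => [|i u _ IH]; first by rewrite tens0p !s0.
rewrite tenspDl !sigmaD IH; congr (_ + _).
by rewrite zc !tenspA !sE; [| right; apply: zc | left; apply: zc].
Qed.

Lemma PsiD t u : Psi (t + u) = Psi t + Psi u.
Proof. by rewrite /Psi /psi_of sigmaD -scalerDr addrACA. Qed.

Lemma PsiK t : Psi (Psi t) = Psi t.
Proof.
have [[_ sl _] _ _] := sigma_can Om.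
have half2 : ((2%:R)^-1 : R[i])%:A + ((2%:R)^-1 : R[i])%:A = 1 :> A.
  by rewrite -scalerDl -mulr2n -(mulr_natl _^-1) mulfV ?scale1r // pnatr_eq0.
rewrite {1}/Psi /psi_of {2}/Psi /psi_of sl sigmaD sigmaK [sigma t + t]addrC.
by rewrite -scalerDl half2 scale1r.
Qed.

Lemma dPsiE s :
  dPsi (form_sum Om s) = dform_sum Om s - Psi (dform_sum Om s).
Proof.
rewrite /dPsi; set r := form_rep _.
have := @JT2_sub _ _ Om (r ++ [seq (- p.1, p.2) | p <- s]).
rewrite form_sum_cat -form_sumN form_repK subrr => /(_ erefl)[t].
rewrite dform_sum_cat -dform_sumN => E.
have -> : dform_sum Om r = dform_sum Om s + Psi t.
  by rewrite /Psi E addrC subrK.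
by rewrite PsiD PsiK opprD addrACA subrr addr0.
Qed.

Definition right_connection (nabla : Om -> T2) : Prop :=
  [/\ forall u v, nabla (u + v) = nabla u + nabla v,
      forall (z : R[i]) u, nabla ((z%:A : A) *: u) = (z%:A : A) *: nabla u
    & forall u a, nabla (u :* a) = nabla u :* a + u *t dd Om a].

Definition conj_connection (nabla : Om -> T2) (w : Om) : T2 :=
  - tdag (nabla (dag w)).

Definition torsion_free (nabla : Om -> T2) : Prop :=
  forall w, (nabla w - Psi (nabla w)) + dPsi w = 0.

Definition hip_r (w : Om) : T2 -> Om := tens_lift (fun u v : Om => hip w u *: v).
Definition hip_l (t : T2) (w : Om) : Om :=
  tens_lift (fun u v : Om => dag v :* hip u w) t.

Definition hermitian_connection (nabla : Om -> T2) : Prop :=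
  forall u v, - hip_l (nabla u) v + hip_r u (nabla v) = dd Om (hip u v).

Definition sigma_dagger_connection (nabla : Om -> T2) : Prop :=
  forall w, sigma (nabla w) = conj_connection nabla w.

Definition levi_civita (nabla : Om -> T2) : Prop :=
  [/\ right_connection nabla, hermitian_connection nabla, torsion_free nabla
    & sigma_dagger_connection nabla].

Lemma rsharp_subproof (w : Om) : `[< right_linear (fun v => hip (dag w) v) >].
Proof.
by apply/asboolP; split=> [u v|u a]; rewrite ?hipDr ?hipZ.
Qed.

Lemma lsharp_subproof (w : Om) : `[< left_linear (fun v : Om => hip (dag v) w) >].
Proof.
by apply/asboolP; split=> [u v|a u]; rewrite ?dagD ?hipDl ?hip_sharpZ.
Qed.

Definition rsharp (w : Om) : rvf Om := RVF (rsharp_subproof w).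
Definition lsharp (w : Om) : lvf Om := LVF (lsharp_subproof w).

(* The two-sided inverses of rsharp and lsharp, by rsharp_bij and lsharp_bij. *)
Definition rflat (X : rvf Om) : Om := xget 0 [set w | rsharp w = X].
Definition lflat (X : lvf Om) : Om := xget 0 [set w | lsharp w = X].

Lemma rsharp_bij (X : rvf Om) : exists! w, rsharp w = X.
Proof.
have [w [wX wU]] := hip_iso (rvf_linear X).
exists w; split; first exact: val_inj.
by move=> w' w'X; apply: wU; rewrite -w'X.
Qed.

Lemma lsharp_bij (X : lvf Om) : exists! w, lsharp w = X.
Proof.
have [XD XZ] := lvf_linear X.
have Xl : right_linear (fun v : Om => star (X (dag v))).
  by split=> [u v|v a]; rewrite ?dagD ?XD ?starD // dagZr XZ starM starK.
have [w [wX wU]] := hip_iso Xl.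
exists (dag w); split.
  apply/val_inj/funext => v /=; have := congr1 star (congr1 (@^~ (dag v)) wX).
  by rewrite /= starK dagK hipS.
move=> w' w'X; rewrite -[w']dagK; congr dag; apply: wU.
by apply/funext => v; rewrite dagK -w'X /= dagK hipS.
Qed.

Lemma rflatK : cancel rflat rsharp.
Proof.
move=> X; have [w [wX _]] := rsharp_bij X.
exact: (@xgetPex _ 0 [set w | rsharp w = X] (ex_intro _ w wX)).
Qed.

Lemma lflatK : cancel lflat lsharp.
Proof.
move=> X; have [w [wX _]] := lsharp_bij X.
exact: (@xgetPex _ 0 [set w | lsharp w = X] (ex_intro _ w wX)).
Qed.

Definition lvf_hip (X Y : lvf Om) : A := hip (lflat X) (lflat Y).
Definition rvf_hip (U V : rvf Om) : A := hip (dag (rflat U)) (dag (rflat V)).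

Definition vf_pair (X : Om -> A) (t : T2) (Y : Om -> A) : A :=
  tens_lift (fun u v : Om => X u * Y v) t.

Definition DC : set (A -> A) :=
  [set del | is_derivation del /\
     forall s : seq (A * A), form_sum Om s = 0 ->
       \sum_(p <- s) p.1 * del p.2 = 0].

(* The total functions phi, nabla_rvf and nabla_lvf below take the junk value *)
(* 0 when the defining formula is not linear as required; phiE, nabla_rvfE    *)
(* and nabla_lvfE show that this does not happen for del in DC.               *)
Definition phi (del : A -> A) : bvf Om :=
  insubd (bvf0 Om) (fun w : Om => \sum_(p <- form_rep w) p.1 * del p.2).

Lemma DC_eq del s t : DC del -> form_sum Om s = form_sum Om t ->
  \sum_(p <- s) p.1 * del p.2 = \sum_(p <- t) p.1 * del p.2.
Proof.
move=> [_ delP] st; apply/eqP; rewrite -subr_eq0; apply/eqP.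
have := delP (s ++ [seq (- p.1, p.2) | p <- t]).
rewrite form_sum_cat -form_sumN st subrr => /(_ erefl) E; apply: etrans E.
rewrite big_cat big_map /= -sumrN; congr (_ + _); apply: eq_bigr => p _ /=.
by rewrite mulNr.
Qed.

Lemma phiE del s : DC del ->
  phi del (form_sum Om s) = \sum_(p <- s) p.1 * del p.2.
Proof.
move=> delD; suff lin : two_sided_linear
    (fun w : Om => \sum_(p <- form_rep w) p.1 * del p.2).
  rewrite /phi -[LHS]/(val _ _) insubdK; last exact/asboolP.
  by apply: DC_eq; rewrite ?form_repK.
have [[delD1 _ delM] _] := delD.
have addP (v w : Om) : \sum_(p <- form_rep (v + w)) p.1 * del p.2 =
    \sum_(p <- form_rep v) p.1 * del p.2
    + \sum_(p <- form_rep w) p.1 * del p.2.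
  by rewrite -big_cat; apply: DC_eq; rewrite ?form_sum_cat ?form_repK.
split; split; [exact: addP | move=> a w | exact: addP | move=> w a].
  rewrite (@DC_eq _ _ [seq (a * p.1, p.2) | p <- form_rep w]) //.
    rewrite big_map mulr_sumr; apply: eq_bigr => p _ /=.
    by rewrite mulrA.
  by rewrite -form_sum_act !form_repK.
rewrite (@DC_eq _ _ ([seq (p.1, p.2 * a) | p <- form_rep w] ++
                     [seq (- (p.1 * p.2), a) | p <- form_rep w])) //.
  rewrite big_cat !big_map /= mulr_suml -big_split; apply: eq_bigr => p _ /=.
  by rewrite delM mulrDr mulNr !mulrA addrK.
by rewrite -form_sum_ract !form_repK.
Qed.

Definition phi_r (del : A -> A) : rvf Om := bvf_right (phi del).
Definition phi_l (del : A -> A) : lvf Om := bvf_left (phi del).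

Definition nabla_rvf (nabla : Om -> T2) (del : A -> A) (X : rvf Om) : rvf Om :=
  insubd (0 : rvf Om)
    (fun w : Om => del (X w) - vf_pair X (nabla w) (phi del)).

Definition nabla_lvf (nablal : Om -> T2) (del : A -> A) (X : lvf Om) : lvf Om :=
  insubd (0 : lvf Om)
    (fun w : Om => del (X w) - vf_pair (phi del) (nablal w) X).

Lemma vf_pair_bal (X Y : Om -> A) : right_linear X -> left_linear Y ->
  balanced (fun u v : Om => X u * Y v).
Proof.
move=> [XD XZ] [YD YZ]; split=> [u u' v|u v v'|u a v].
- by rewrite XD mulrDl.
- by rewrite YD mulrDr.
- by rewrite XZ YZ mulrA.
Qed.

Lemma conj_connectionP nabla : right_connection nabla ->
  (forall u v, conj_connection nabla (u + v) =
     conj_connection nabla u + conj_connection nabla v) /\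
  (forall a u, conj_connection nabla (a *: u) =
     a *: conj_connection nabla u + dd Om a *t u).
Proof.
move=> [nD _ nZ]; rewrite /conj_connection.
split=> [u v|a u]; first by rewrite dagD nD tdagD opprD.
rewrite dagZl nZ tdagD tdagZr starK tdagE dagK dd_star dagN dagK.
by rewrite opprD scalerN tenspNl opprK.
Qed.

Lemma vf_pairD (X Y : Om -> A) t u : right_linear X -> left_linear Y ->
  vf_pair X (t + u) Y = vf_pair X t Y + vf_pair X u Y.
Proof. by move=> Xl Yl; apply/tens_liftD/vf_pair_bal. Qed.

Lemma vf_pair0 (X Y : Om -> A) : right_linear X -> left_linear Y ->
  vf_pair X 0 Y = 0.
Proof. by move=> Xl Yl; apply/tens_lift0/vf_pair_bal. Qed.

Lemma vf_pairE (X Y : Om -> A) u v : right_linear X -> left_linear Y ->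
  vf_pair X (u *t v) Y = X u * Y v.
Proof. by move=> Xl Yl; apply/tens_liftE/vf_pair_bal. Qed.

Lemma vf_pairZr (X : Om -> A) (Y : bvf Om) t a : right_linear X ->
  vf_pair X (t :* a) Y = vf_pair X t Y * a.
Proof.
move=> Xl; have [Yl [_ YZ]] := bvf_linear Y.
elim/(@tens_ind A Om Om): t => [|t u IHt IHu|x y].
- by rewrite ract0l vf_pair0 // mul0r.
- by rewrite ractDl !vf_pairD // IHt IHu mulrDl.
- by rewrite tens_ractE !vf_pairE // YZ mulrA.
Qed.

Lemma vf_pairZl (X : bvf Om) (Y : Om -> A) t a : left_linear Y ->
  vf_pair X (a *: t) Y = a * vf_pair X t Y.
Proof.
move=> Yl; have [[_ XZ] Xl] := bvf_linear X.
elim/(@tens_ind A Om Om): t => [|t u IHt IHu|x y].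
- by rewrite scaler0 vf_pair0 // mulr0.
- by rewrite scalerDr !vf_pairD // IHt IHu mulrDr.
- by rewrite tens_lactE !vf_pairE // XZ mulrA.
Qed.

Lemma phi_dd del a : DC del -> phi del (dd Om a) = del a.
Proof.
move=> delD; have := @phiE del [:: (1, a)] delD.
by rewrite /form_sum !big_seq1 /= scale1r mul1r.
Qed.

Lemma nabla_rvfE nabla del (X : rvf Om) w : right_connection nabla -> DC del ->
  nabla_rvf nabla del X w = del (X w) - vf_pair X (nabla w) (phi del).
Proof.
move=> [nD _ nZ] delD; have [[delA _ delM] _] := delD.
have Xl := rvf_linear X; have [XD XZ] := Xl.
have [Pl _] := bvf_linear (phi del).
rewrite /nabla_rvf -[LHS]/(val _ _) insubdK //; apply/asboolP.
split=> [u v|u a]; first by rewrite XD delA nD vf_pairD // opprD addrACA.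
rewrite XZ delM nZ vf_pairD // vf_pairZr // vf_pairE // phi_dd //.
by rewrite opprD addrACA subrr addr0 mulrBl.
Qed.

Lemma nabla_lvfE nabla del (X : lvf Om) w : right_connection nabla -> DC del ->
  nabla_lvf (conj_connection nabla) del X w =
  del (X w) - vf_pair (phi del) (conj_connection nabla w) X.
Proof.
move=> /conj_connectionP[nD nZ] delD; have [[delA _ delM] _] := delD.
have Xl := lvf_linear X; have [XD XZ] := Xl.
have [_ Pr] := bvf_linear (phi del).
rewrite /nabla_lvf -[LHS]/(val _ _) insubdK //; apply/asboolP.
split=> [u v|a u]; first by rewrite XD delA nD vf_pairD // opprD addrACA.
rewrite XZ delM nZ vf_pairD // vf_pairZl // vf_pairE // phi_dd //.
by rewrite [X in X - _]addrC opprD addrACA subrr addr0 mulrBr.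
Qed.

End CentredCalculus.

(* Main.v *)
Require Import Defs.
From HB Require Import structures.
From mathcomp Require Import all_boot all_order all_algebra.
From mathcomp Require Import complex.
From mathcomp Require Import boolp classical_sets functions reals.

(* On a centred calculus everything is detected by central forms: elements of *)
(* T2 are separated by pairing both legs with central forms, and sending a    *)
(* central form x to a |-> <x, da>, where <x, y> is the bilinear pairing      *)
(* hip (dag x) y, identifies the central forms with the derivations in DC,    *)
(* whose Lie bracket stays in DC because JT2 lies in the image of Psi. For a  *)
(* right connection, being Levi-Civita amounts to the two Koszul identities   *)
(*   G(x, y, z) + G(x, z, y) = x(<y, z>),                                     *)
(*   G(x, y, z) - G(y, x, z) = <[x, y], z>                                    *)
(* on central forms, where G(x, y, z) = <<z | nabla y | x>>. The braid        *)
(* argument shows that they have at most one solution; applied to commutators *)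
(* and to the conjugate of G, it also shows that G takes values in the centre *)
(* of A and that G(dag x, dag y, dag z) = - star G(x, y, z). A solution is    *)
(* given by 2 nabla_x y = d<x, y> + [x, y] + i_x dy + i_y dx, extended to all *)
(* forms by a dual basis.                                                     *)
(* The induced affine connections map phi(D) to itself, so that the reality   *)
(* of <nabla X, Y> and <nabla nabla X, Y> reduces to that of <X, Y>. The left *)
(* calculus is the image of the right one under X |-> (w |-> star X(dag w)).  *)

Set Implicit Arguments.
Unset Strict Implicit.
Unset Printing Implicit Defensive.

Import GRing.Theory Num.Theory.

Local Open Scope ring_scope.
Local Open Scope complex_scope.
Local Open Scope classical_set_scope.

(** The proof runs the classical Koszul argument on central forms. They generate all forms over A,
    and by [bilC] and [bil_central_comm] the pairing [bil] is symmetric on them with values in the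
    centre of A, so the commutative manipulations remain valid. Conclusions return to all forms and
    tensors through [bil_central_inj] and [T2_sep], constructions through [central_ext]. A central
    form x is also a derivation [der x] in [DC Om]; brackets exist by [DC_bracket], and [dPsi] obeys
    Cartan's formula ([dPsi_pair]).

    By [lc_koszul] and [koszul_lc], a right connection is Levi-Civita exactly when its [christoffel]
    satisfies [koszul]. Two solutions differ by something symmetric in the first two slots and
    antisymmetric in the last two, hence zero ([braid_zero]). This gives uniqueness, and also the
    centrality and reality of the coefficients ([koszul_comm], [koszul_star]). For existence,
    [koszul_form] solves the identities; [christoffel_exists] and [right_connection_exists] extend
    it to a connection by checking that relations among central forms are respected.

    By [nabla_lsharp] the induced connection sends central fields to central fields with
    [christoffel] as coefficients, so metric compatibility and vanishing torsion are again the
    Koszul identities. Reality holds because phi(D) is stable under the connection ([nabla_phi_l]).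
    The left calculus is carried over by [rvf_dag], and strong non-degeneracy is [hip_iso] read
    through the musical isomorphisms. *)

Definition free_rmod (A : pzRingType) (n : nat) : Type := {ffun 'I_n -> A}.

Section FreeRmod.
Variables (A : pzRingType) (n : nat).

HB.instance Definition _ := GRing.Zmodule.on (free_rmod A n).

Definition free_ract (x : free_rmod A n) (a : A) : free_rmod A n :=
  [ffun i => x i * a].

Lemma free_ractA x a b : free_ract (free_ract x a) b = free_ract x (a * b).
Proof. by apply/ffunP => i; rewrite !ffunE mulrA. Qed.
Lemma free_ract1 x : free_ract x 1 = x.
Proof. by apply/ffunP => i; rewrite ffunE mulr1. Qed.
Lemma free_ractDl x y a : free_ract (x + y) a = free_ract x a + free_ract y a.
Proof. by apply/ffunP => i; rewrite !ffunE mulrDl. Qed.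
Lemma free_ractDr x a b : free_ract x (a + b) = free_ract x a + free_ract x b.
Proof. by apply/ffunP => i; rewrite !ffunE mulrDr. Qed.

HB.instance Definition _ := Zmodule_isRmodule.Build A (free_rmod A n)
  free_ractA free_ract1 free_ractDl free_ractDr.

End FreeRmod.

(** * The bilinear pairing, central forms and dual bases *)

Section Pairing.
Context {R : realType} {A : starAlgType R} (Om : hermFirstOrder A).
Implicit Types (u v w x y z : Om) (a b : A).

Lemma star0 : star (0 : A) = 0.
Proof. by apply: (addIr (star (0 : A))); rewrite -starD !add0r. Qed.

Lemma starN a : star (- a) = - star a.
Proof. by apply: (addIr (star a)); rewrite -starD !addNr star0. Qed.

Lemma dd1 : dd Om 1 = 0.
Proof.
apply: (addIr (dd Om 1)); rewrite add0r -{3}[1]mulr1 ddM.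
by rewrite ract1 scale1r.
Qed.

Lemma dd_scalar (c : R[i]) : dd Om c%:A = 0.
Proof. by rewrite ddZ dd1 scaler0. Qed.

Lemma scalar_comm (c : R[i]) a : c%:A * a = a * c%:A.
Proof. by rewrite -scalerAl mul1r -scalerAr mulr1. Qed.

(** Minus the metric g on the tensor of x and w: left-linear in x, right-linear in w and balanced
    over A, unlike the sesquilinear [hip]. *)
Definition bil x w : A := hip (dag x) w.

Lemma bilDl x y w : bil (x + y) w = bil x w + bil y w.
Proof. by rewrite /bil dagD hipDl. Qed.

Lemma bilDr x v w : bil x (v + w) = bil x v + bil x w.
Proof. exact: hipDr. Qed.

Lemma bil0l w : bil 0 w = 0.
Proof. by apply: (addIr (bil 0 w)); rewrite -bilDl !add0r. Qed.

Lemma bil0r x : bil x 0 = 0.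
Proof. by apply: (addIr (bil x 0)); rewrite -bilDr !add0r. Qed.

Lemma bilNl x w : bil (- x) w = - bil x w.
Proof. by apply: (addIr (bil x w)); rewrite -bilDl !addNr bil0l. Qed.

Lemma bilNr x w : bil x (- w) = - bil x w.
Proof. by apply: (addIr (bil x w)); rewrite -bilDr !addNr bil0r. Qed.

Lemma bil_sumr I (r : seq I) (P : pred I) (F : I -> Om) w :
  bil w (\sum_(i <- r | P i) F i) = \sum_(i <- r | P i) bil w (F i).
Proof. by elim/big_rec2: _ => [|i u v _ <-]; rewrite ?bil0r ?bilDr. Qed.

Lemma bilZl a x w : bil (a *: x) w = a * bil x w.
Proof. exact: hip_sharpZ. Qed.

Lemma bilZr x w a : bil x (w :* a) = bil x w * a.
Proof. exact: hipZ. Qed.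

Lemma bilA x a w : bil (x :* a) w = bil x (a *: w).
Proof. by rewrite /bil dagZr hip_act starK. Qed.

Lemma bil_dag x w : bil (dag x) (dag w) = star (bil w x).
Proof. by rewrite /bil dagK hipS. Qed.

Lemma bil_right_linear x : right_linear (bil x).
Proof. by split=> [u v|u a]; rewrite ?bilDr ?bilZr. Qed.

Lemma bil_inj u v : (forall w, bil u w = bil v w) -> u = v.
Proof.
move=> uv; have [x [_ xU]] := hip_iso (bil_right_linear u).
by rewrite -(xU u) // -(xU v) //; apply/funext => w; rewrite -[LHS]uv.
Qed.

Lemma central_dag x : central x -> central (dag x).
Proof. by move=> xc a; rewrite -[a]starK -dagZr -dagZl xc. Qed.

Lemma centralD x y : central x -> central y -> central (x + y).
Proof. by move=> xc yc a; rewrite scalerDr ractDl xc yc. Qed.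

Lemma centralN x : central x -> central (- x).
Proof. by move=> xc a; rewrite scalerN ractNl xc. Qed.

Lemma centralZ x a : (forall b, a * b = b * a) -> central x -> central (a *: x).
Proof.
by move=> ac xc b; rewrite scalerA -ac -scalerA xc bimodA.
Qed.

Lemma bil_centralZ x a w : central x -> bil x (a *: w) = a * bil x w.
Proof. by move=> xc; rewrite -bilA -xc bilZl. Qed.

Lemma bil_left_linear x : central x -> left_linear (bil x).
Proof. by move=> xc; split=> [u v|a u]; rewrite ?bilDr ?bil_centralZ. Qed.

Lemma bil_centralP x : left_linear (bil x) -> central x.
Proof.
by move=> [_ xZ] a; apply: bil_inj => w; rewrite bilZl bilA xZ.
Qed.

Lemma bil_central_comm x y a : central x -> central y ->
  a * bil x y = bil x y * a.
Proof. by move=> xc yc; rewrite -bil_centralZ // yc bilZr. Qed.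

Definition der x a : A := bil x (dd Om a).

Lemma derD x a b : der x (a + b) = der x a + der x b.
Proof. by rewrite /der ddD bilDr. Qed.

Lemma der0 x : der x 0 = 0.
Proof. by apply: (addIr (der x 0)); rewrite -derD !add0r. Qed.

Lemma derN x a : der x (- a) = - der x a.
Proof. by apply: (addIr (der x a)); rewrite -derD !addNr der0. Qed.

Lemma derM x a b : central x -> der x (a * b) = der x a * b + a * der x b.
Proof. by move=> xc; rewrite /der ddM bilDr bilZr bil_centralZ. Qed.

Lemma der_is_derivation x : central x -> is_derivation (der x).
Proof.
move=> xc; split=> [a b|c a|a b]; rewrite ?derD ?derM //.
by rewrite /der ddZ bil_centralZ // -scalerAl mul1r.
Qed.

(** Differentiate b a = a b; the terms with [der x b] cancel because a is central. *)
Lemma der_comm x a b : central x -> (forall c, c * a = a * c) ->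
  b * der x a = der x a * b.
Proof.
move=> xc ac; have := congr1 (der x) (ac b).
by rewrite !derM // ac [RHS]addrC => /addrI.
Qed.

(** Projectivity lifts the identity through a surjection from a free module. The coordinates of the
    lift are right-linear functionals, so strong non-degeneracy represents each of them by a
    form. *)
Lemma frame : exists n (e f : 'I_n -> Om),
  forall w, w = \sum_i e i :* hip (f i) w.
Proof.
have [n [e eP]] := forms_fg Om.
pose p (c : free_rmod A n) : Om := \sum_i e i :* c i.
have ph : rmod_hom p.
  split=> [c c'|c a]; rewrite /p.
    by rewrite -big_split; apply: eq_bigr => i _; rewrite ffunE ractDr.
  by rewrite ract_suml; apply: eq_bigr => i _; rewrite ffunE ractA.
have idh : rmod_hom (id : Om -> Om) by [].
have psurj v : exists c, p c = v.
  by have [c ->] := eP v; exists [ffun i => c i]; apply: eq_bigr => i _;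
    rewrite ffunE.
have [h [[hD hZ] hK]] := forms_proj ph idh psurj.
have hl i : right_linear (fun w => h w i).
  by split=> [u v|u a]; rewrite ?hD ?hZ ffunE.
have fP i : exists f, forall w, h w i = hip f w.
  have [u [uE _]] := hip_iso (hl i); exists (dag u) => w.
  by rewrite -[RHS]/((fun v => hip (dag u) v) w) uE.
exists n, e, (fun i => sval (cid (fP i))) => w.
rewrite -{1}[w]hK; apply: eq_bigr => i _.
by case: cid => f /= ->.
Qed.

End Pairing.

(** * Generation by central forms *)

Section Centred.
Context {R : realType} {A : starAlgType R} (Om : centredCalculus A).
Implicit Types (u v w x y z : Om) (a b c : A) (t : T2 Om).

(** Invariance of the metric under [sigma], evaluated on the tensor of x and w, which [sigma] flips
    because x is central. *)
Lemma bilC x w : central x -> bil x w = bil w x.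
Proof.
have mE u v : metric_map (u *t v : T2 Om) = - bil u v.
  rewrite /metric_map tens_liftE //.
  by split=> *; rewrite -?/(bil _ _) -?opprD ?bilDl ?bilDr ?bilA.
move=> xc; have [_ _ sE] := sigma_can Om.
have := metric_sigma (x *t w : T2 Om).
by rewrite sE; [rewrite !mE => /oppr_inj | left].
Qed.

Definition central_seq (s : seq (Om * A)) : Prop :=
  forall p, p \in s -> central p.1.

Lemma central_seq_cat s s' :
  central_seq s -> central_seq s' -> central_seq (s ++ s').
Proof. by move=> sc sc' p; rewrite mem_cat => /orP[/sc|/sc']. Qed.

Lemma central_seq_map s (f : A -> A) :
  central_seq s -> central_seq [seq (p.1, f p.2) | p <- s].
Proof. by move=> sc p /mapP[q /sc qc ->]. Qed.

Definition act_sum (s : seq (Om * A)) : Om := \sum_(p <- s) p.1 :* p.2.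

Lemma act_sum_cat s s' : act_sum (s ++ s') = act_sum s + act_sum s'.
Proof. by rewrite /act_sum big_cat. Qed.

Lemma act_sumN s : act_sum [seq (p.1, - p.2) | p <- s] = - act_sum s.
Proof.
by rewrite /act_sum big_map -sumrN; apply: eq_bigr => p _; rewrite ractNr.
Qed.

Lemma act_sum_ract s a : act_sum [seq (p.1, p.2 * a) | p <- s] = act_sum s :* a.
Proof.
by rewrite /act_sum big_map ract_suml; apply: eq_bigr => p _; rewrite ractA.
Qed.

Lemma act_sumP w : exists2 s, central_seq s & w = act_sum s.
Proof.
have [n [a [b [z [zc ->]]]]] := forms_centred w.
exists [seq (z i, a i * b i) | i <- index_enum 'I_n].
  by move=> p /mapP[i _ ->]; apply: zc.
by rewrite /act_sum big_map; apply: eq_bigr => i _; rewrite zc ractA.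
Qed.

Lemma central_ind (P : Om -> Prop) : P 0 ->
  (forall u v, P u -> P v -> P (u + v)) ->
  (forall x a, central x -> P (x :* a)) -> forall w, P w.
Proof.
move=> P0 PD Pc w; have [s sc ->] := act_sumP w; rewrite /act_sum big_seq.
by elim/big_ind: _ => // p /sc; apply: Pc.
Qed.

(** Defines a map on forms by generators and relations: the values prescribed on x :* a with x
    central must respect every relation among central generators. Additivity of F then follows by
    concatenating lists. *)
Lemma central_ext (V : zmodType) (f : Om -> A -> V) :
  (forall x a, central x -> f x (- a) = - f x a) ->
  (forall s, central_seq s -> act_sum s = 0 -> \sum_(p <- s) f p.1 p.2 = 0) ->
  exists F : Om -> V, forall s, central_seq s ->
    F (act_sum s) = \sum_(p <- s) f p.1 p.2.
Proof.
move=> fN f0; pose r w := s2val (cid2 (act_sumP w)).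
have rc w : central_seq (r w) by rewrite /r; case: cid2.
have rE w : act_sum (r w) = w by rewrite /r; case: cid2.
exists (fun w => \sum_(p <- r w) f p.1 p.2) => s sc.
apply/eqP; rewrite -subr_eq0; apply/eqP.
have rsc : central_seq (r (act_sum s) ++ [seq (p.1, - p.2) | p <- s]).
  exact/central_seq_cat/central_seq_map.
have := f0 _ rsc; rewrite act_sum_cat act_sumN rE subrr big_cat big_map /=.
move=> /(_ erefl) E; apply: etrans E; congr (_ + _).
rewrite -sumrN big_seq [RHS]big_seq; apply: eq_bigr => p /sc pc.
by rewrite fN.
Qed.

Lemma bil_central_inj u v :
  (forall z, central z -> bil z u = bil z v) -> u = v.
Proof.
move=> uv; apply: bil_inj; elim/central_ind => [|w w' IH IH'|x a xc].
- by rewrite !bil0r.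
- by rewrite !bilDr IH IH'.
- by rewrite !bilZr -!(bilC _ xc) uv.
Qed.

(** * Contraction of tensors with two forms *)

Definition tpair z t x : A := vf_pair (bil z) t (bil x).

Lemma tpairD z t t' x : central x -> tpair z (t + t') x = tpair z t x + tpair z
  t' x.
Proof.
by move=> xc; apply: vf_pairD; [apply: bil_right_linear|apply: bil_left_linear].
Qed.

Lemma tpair0 z x : central x -> tpair z 0 x = 0.
Proof.
by move=> xc; apply: vf_pair0; [apply: bil_right_linear|apply: bil_left_linear].
Qed.

Lemma tpairN z t x : central x -> tpair z (- t) x = - tpair z t x.
Proof.
by move=> xc; apply: (addIr (tpair z t x)); rewrite -tpairD // !addNr tpair0.
Qed.

Lemma tpairE z u v x : central x -> tpair z (u *t v) x = bil z u * bil x v.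
Proof.
by move=> xc; apply: vf_pairE; [apply: bil_right_linear|apply: bil_left_linear].
Qed.

Lemma tpair_sum z x I (r : seq I) (P : pred I) (F : I -> T2 Om) : central x ->
  tpair z (\sum_(i <- r | P i) F i) x = \sum_(i <- r | P i) tpair z (F i) x.
Proof. by move=> xc; elim/big_rec2: _ => [|i u v _ <-]; rewrite ?tpair0
  ?tpairD. Qed.

Lemma tpair_ract z t a x : central x -> tpair z (t :* a) x = tpair z t x * a.
Proof.
move=> xc; elim/(@tens_ind A Om Om): t => [|t u IHt IHu|u v].
- by rewrite ract0l tpair0 // mul0r.
- by rewrite ractDl !tpairD // IHt IHu mulrDl.
- by rewrite tens_ractE !tpairE // bilZr mulrA.
Qed.

Lemma tpair_lact z t a x : central x -> central z -> tpair z (a *: t) x = a *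
  tpair z t x.
Proof.
move=> xc zc; elim/(@tens_ind A Om Om): t => [|t u IHt IHu|u v].
- by rewrite scaler0 tpair0 // mulr0.
- by rewrite scalerDr !tpairD // IHt IHu mulrDr.
- by rewrite tens_lactE !tpairE // bil_centralZ // mulrA.
Qed.

Lemma tensp0 u : u *t (0 : Om) = 0.
Proof. by rewrite -(scale0r (0 : Om)) -tenspA ract0r tens0p. Qed.

Lemma tens_central_ind (P : T2 Om -> Prop) : P 0 ->
  (forall t t', P t -> P t' -> P (t + t')) ->
  (forall x y a, central x -> central y -> P ((x *t y : T2 Om) :* a)) ->
  forall t, P t.
Proof.
move=> P0 PD Pc; apply: tens_ind => // u v.
elim/central_ind: u => [|u u' IH IH'|x a xc].
- by rewrite tens0p.
- by rewrite tenspDl; apply: PD.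
elim/central_ind: v => [|v v' IH IH'|y b yc].
- by rewrite tensp0.
- by rewrite tenspDr; apply: PD.
- by rewrite tenspA bimodA yc -!tens_ractE ractA; apply: Pc.
Qed.

(** Tensors of central forms generate [T2 Om]; [sigma] flips them, and the two resulting values
    commute. *)
Lemma tpair_sigma z t x : central x -> central z -> tpair z (sigma t) x = tpair
  x t z.
Proof.
move=> xc zc; have [[sD _ sr] _ sE] := sigma_can Om.
elim/tens_central_ind: t => [|t t' IH IH'|u v a uc vc].
- by rewrite -[0](ract0r 0) sr !tpair_ract // !mulr0.
- by rewrite sD !tpairD // IH IH'.
- rewrite sr !tpair_ract // sE; last by left.
  by rewrite !tpairE // bil_central_comm.
Qed.

Lemma tpair_tdag z t x : central x -> central z ->
  tpair z (tdag t) x = star (tpair (dag x) t (dag z)).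
Proof.
move=> xc zc; have [xc' zc'] := (central_dag xc, central_dag zc).
elim/(@tens_ind A Om Om): t => [|t u IHt IHu|u v].
- by rewrite tdag0 !tpair0 // star0.
- by rewrite tdagD !tpairD // starD IHt IHu.
- rewrite tdagE !tpairE // starM -{1}[z]dagK -{1}[x]dagK !bil_dag.
  by rewrite -![bil _ (dag _)]bilC.
Qed.

Lemma hip_r_bal w : balanced (fun u v : Om => hip w u *: v).
Proof.
split=> *; rewrite ?hipDr ?scalerDl ?scalerDr //.
by rewrite hipZ scalerA.
Qed.

Lemma bil_hip_r x w t : central x -> bil x (hip_r w t) = tpair (dag w) t x.
Proof.
move=> xc; elim/(@tens_ind A Om Om): t => [|t u IHt IHu|u v].
- by rewrite tpair0 // /hip_r (tens_lift0 (hip_r_bal w)) bil0r.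
- by rewrite tpairD // /hip_r (tens_liftD (hip_r_bal w)) bilDr IHt IHu.
- by rewrite tpairE // /hip_r (tens_liftE (hip_r_bal w)) bil_centralZ // /bil
    dagK.
Qed.

Lemma tpairDl z z' t x : central x -> tpair (z + z') t x = tpair z t x + tpair
  z' t x.
Proof.
move=> xc; elim/(@tens_ind A Om Om): t => [|t u IHt IHu|u v].
- by rewrite !tpair0 // addr0.
- by rewrite !tpairD // IHt IHu addrACA.
- by rewrite !tpairE // bilDl mulrDl.
Qed.

Lemma tpairZl a z t x : central x -> tpair (a *: z) t x = a * tpair z t x.
Proof.
move=> xc; elim/(@tens_ind A Om Om): t => [|t u IHt IHu|u v].
- by rewrite !tpair0 // mulr0.
- by rewrite !tpairD // IHt IHu mulrDr.
- by rewrite !tpairE // bilZl mulrA.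
Qed.

Lemma tens_frame n (e f : 'I_n -> Om) :
  (forall w, w = \sum_i e i :* hip (f i) w) ->
  forall t, t = \sum_i e i *t hip_r (f i) t.
Proof.
move=> ef t; elim/(@tens_ind A Om Om): t => [|t u IHt IHu|u v].
- rewrite big1 // => i _; rewrite /hip_r (tens_lift0 (hip_r_bal _)).
  exact: tensp0.
- rewrite {1}IHt {1}IHu -big_split; apply: eq_bigr => i _ /=.
  by rewrite -tenspDr /hip_r (tens_liftD (hip_r_bal _)).
- rewrite {1}[u]ef (big_morph (fun w => w *t v : T2 Om) (fun _ _ => tenspDl _ _
    _) (tens0p _ _)).
  by apply: eq_bigr => i _; rewrite tenspA /hip_r (tens_liftE (hip_r_bal _)).
Qed.

(** [tens_frame] reduces the equality to that of the contractions [hip_r (f i) t], which central x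
    separate. The form left in the first slot, [dag (f i)], need not be central, but [tpair] is
    left-linear there, so central z suffice. *)
Lemma T2_sep t t' :
  (forall z x, central z -> central x -> tpair z t x = tpair z t' x) -> t = t'.
Proof.
move=> tt'; have [n [e [f ef]]] := frame Om.
have pE z x : central x -> tpair z t x = tpair z t' x.
  move=> xc; elim/central_ind: z => [|z z' IH IH'|z a zc].
  - by rewrite -[0](scale0r 0) !tpairZl // !mul0r.
  - by rewrite !tpairDl // IH IH'.
  - by rewrite -zc !tpairZl // tt'.
rewrite (tens_frame ef t) (tens_frame ef t'); apply: eq_bigr => i _.
congr (_ *t _); apply: bil_central_inj => x xc.
by rewrite !bil_hip_r // pE.
Qed.

(** * Central forms as derivations, brackets and Cartan's formula *)

Definition der_form (del : A -> A) : Om := rflat (phi_r Om del).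

Lemma bil_der_form del w : bil (der_form del) w = phi Om del w.
Proof. by rewrite -[LHS]/(rsharp (der_form del) w) rflatK. Qed.

Lemma central_der_form del : central (der_form del).
Proof.
apply: bil_centralP; have [[pD pZ] _] := bvf_linear (phi Om del).
by split=> [u v|a u]; rewrite !bil_der_form.
Qed.

Lemma der_formK del a : DC Om del -> der (der_form del) a = del a.
Proof. by move=> delD; rewrite /der bil_der_form phi_dd. Qed.

Lemma bil_form_sum x s : central x ->
  bil x (form_sum Om s) = \sum_(p <- s) p.1 * der x p.2.
Proof.
move=> xc; rewrite bil_sumr; apply: eq_bigr => p _.
by rewrite bil_centralZ.
Qed.

Lemma DC_der x : central x -> DC Om (der x).
Proof.
move=> xc; split; first exact: der_is_derivation.
by move=> s s0; rewrite -bil_form_sum // s0 bil0r.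
Qed.

Lemma phi_der x w : central x -> phi Om (der x) w = bil x w.
Proof.
move=> xc; rewrite -[w]form_repK phiE ?bil_form_sum //; exact: DC_der.
Qed.

Lemma der_inj x y : central x -> central y -> der x =1 der y -> x = y.
Proof.
move=> xc yc xy; apply: bil_inj => w; rewrite -[w]form_repK !bil_form_sum //.
by apply: eq_bigr => p _; rewrite xy.
Qed.

(** The Leibniz rule splits the derivative into a contraction of sum da (x) db and a second-order
    part, whose antisymmetrization in x and z is the action of the commutator. *)
Lemma der_bil_form_sum x z s : central x -> central z ->
  der x (bil z (form_sum Om s)) =
  tpair x (dform_sum Om s) z + \sum_(p <- s) p.1 * der x (der z p.2).
Proof.
move=> xc zc; rewrite bil_form_sum //.
rewrite (big_morph _ (derD x) (der0 x)) tpair_sum // -big_split; apply: eq_bigr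
  => p _ /=.
by rewrite derM // tpairE.
Qed.

Definition half_scalar : A := ((2%:R)^-1 : R[i])%:A.

Lemma half_scalarD : half_scalar + half_scalar = 1.
Proof.
rewrite -scalerDl -mulr2n -(mulr_natl _^-1) mulfV ?scale1r //.
by rewrite pnatr_eq0.
Qed.

Lemma half_scalarDl a : half_scalar * a + half_scalar * a = a.
Proof. by rewrite -mulrDl half_scalarD mul1r. Qed.

Lemma addrr_inj a b : a + a = b + b -> a = b.
Proof. by move=> ab; rewrite -[a]half_scalarDl -[b]half_scalarDl -!mulrDr ab.
  Qed.

Lemma tpair_Psi x z t : central x -> central z ->
  tpair x (Psi t) z = half_scalar * (tpair x t z + tpair z t x).
Proof. by move=> xc zc; rewrite tpair_lact // tpairD // tpair_sigma. Qed.

(** If sum a db = 0, then sum da (x) db lies in the image of [Psi], so its contraction is symmetric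
    in x and y. Subtracting the two instances of [der_bil_form_sum] leaves sum a [x, y](b) = 0. *)
Lemma DC_bracket x y : central x -> central y ->
  DC Om (lie_bracket (der x) (der y)).
Proof.
move=> xc yc; split.
  have [xD xZ _] := der_is_derivation xc; have [yD yZ _] := der_is_derivation
    yc.
  split=> [a b|c a|a b]; rewrite /lie_bracket.
  - by rewrite yD xD xD yD opprD addrACA.
  - by rewrite yZ xZ xZ yZ scalerBr.
  - rewrite !derM // xD yD !derM // mulrBl mulrBr [X in _ - X]addrACA.
    rewrite opprD addrACA [der y (der x a) * b + _]addrC addrKA.
    by rewrite [_ + a * der x (der y b)]addrC addrKA.
move=> s s0; have [t tE] := JT2_sub s0.
have prC : tpair x (dform_sum Om s) y = tpair y (dform_sum Om s) x.
  by rewrite -tE -/(Psi t) !tpair_Psi // [X in half_scalar * X]addrC.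
have := der_bil_form_sum s xc yc; have := der_bil_form_sum s yc xc.
rewrite s0 !bil0r !der0 prC => {1}-> /addrI E; rewrite /lie_bracket.
by under eq_bigr do rewrite mulrBr; rewrite sumrB E subrr.
Qed.

Definition bracket x y : Om := der_form (lie_bracket (der x) (der y)).

Lemma central_bracket x y : central (bracket x y).
Proof. exact: central_der_form. Qed.

Lemma der_bracketE x y a : central x -> central y ->
  der (bracket x y) a = der x (der y a) - der y (der x a).
Proof. by move=> xc yc; rewrite der_formK //; apply: DC_bracket. Qed.

Lemma bracketN x y : central x -> central y -> bracket y x = - bracket x y.
Proof.
move=> xc yc; apply: der_inj.
- exact: central_bracket.
- exact/centralN/central_bracket.
by move=> a; rewrite /der bilNl -!/(der _ _) !der_bracketE // opprB.
Qed.

Lemma der_dag x a : central x -> der (dag x) (star a) = - star (der x a).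
Proof. by move=> xc; rewrite /der dd_star bilNr bil_dag (bilC _ xc). Qed.

(** The derivation a |-> star (der x (star a)) corresponds to - dag x, and this conjugation respects
    commutators; the two signs inside the bracket cancel, the outer one stays. *)
Lemma bracket_dag x y : central x -> central y -> bracket (dag x) (dag y) = -
  dag (bracket x y).
Proof.
move=> xc yc; have [xc' yc'] := (central_dag xc, central_dag yc).
apply: der_inj; [exact:
  central_bracket|exact/centralN/central_dag/central_bracket|].
move=> a; rewrite -[a]starK [RHS]bilNl -/(der _ _) der_bracketE //.
rewrite (der_dag _ (central_bracket x y)) opprK der_bracketE // !der_dag //.
by rewrite !derN !der_dag // !opprK starD starN.
Qed.

(** Cartan's formula for the exterior derivative, doubled because 1 - Psi is half of 1 - sigma. *)
Lemma dPsi_pair x y z : central x -> central z ->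
  tpair x (dPsi y) z + tpair x (dPsi y) z =
  der x (bil z y) - der z (bil x y) - bil (bracket x z) y.
Proof.
move=> xc zc; rewrite -[y]form_repK !dPsiE; set s := form_rep y.
rewrite !der_bil_form_sum // bil_form_sum; last exact: central_bracket.
rewrite -/(Psi _) tpairD // tpairN // tpair_Psi // addrACA -opprD half_scalarDl.
under [X in _ = _ - X]eq_bigr do rewrite der_bracketE // mulrBr.
by rewrite sumrB addrKA opprD [X in _ = X - _]addrACA addrK.
Qed.

(** * The Koszul identities and the rigidity of their solutions *)

Definition koszul (G : Om -> Om -> Om -> A) : Prop :=
  (forall x y z, central x -> central y -> central z ->
     G x y z + G x z y = der x (bil y z)) /\
  (forall x y z, central x -> central y -> central z ->
     G x y z - G y x z = bil (bracket x y) z).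

(** Alternating the two exchanges returns to G x y z after six moves, three of which change the
    sign; hence 2 G = 0. *)
Lemma braid_zero (G : Om -> Om -> Om -> A) :
  (forall x y z, central x -> central y -> central z -> G x y z + G x z y = 0)
    ->
  (forall x y z, central x -> central y -> central z -> G x y z = G y x z) ->
  forall x y z, central x -> central y -> central z -> G x y z = 0.
Proof.
move=> GN GC x y z xc yc zc; apply: addrr_inj; rewrite addr0.
have GE u v w : central u -> central v -> central w -> G u v w = - G u w v.
  by move=> uc vc wc; apply/eqP; rewrite -addr_eq0 GN.
rewrite {1}GE // [G x z y]GC // GE // opprK GC // GE // GC //.
by rewrite addNr.
Qed.

Lemma koszul_uniq G G' : koszul G -> koszul G' ->
  forall x y z, central x -> central y -> central z -> G x y z = G' x y z.
Proof.
move=> [Ga Gb] [Ga' Gb'] x y z xc yc zc; apply/eqP; rewrite -subr_eq0;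
  apply/eqP.
apply: (braid_zero (G := fun x y z => G x y z - G' x y z)) => //.
  by move=> u v w uc vc wc; rewrite addrACA -opprD Ga // Ga' // subrr.
move=> u v w uc vc wc; apply/eqP; rewrite -subr_eq0 opprD opprK addrACA.
by rewrite [X in _ + X]addrC Gb // -opprB Gb' // subrr.
Qed.

(** The commutator of G with a satisfies the homogeneous identities, because the right-hand sides of
    [koszul] are central in A: pairings of central forms, and by [der_comm] their derivatives. *)
Lemma koszul_comm G : koszul G ->
  forall x y z a, central x -> central y -> central z -> a * G x y z = G x y z
    * a.
Proof.
move=> [Ga Gb] x y z a xc yc zc; apply/eqP; rewrite -subr_eq0; apply/eqP.
apply: (braid_zero (G := fun x y z => a * G x y z - G x y z * a)) => //.
  move=> u v w uc vc wc; rewrite addrACA -opprD -mulrDr -mulrDl Ga //.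
  by rewrite (der_comm a uc (fun c => bil_central_comm c vc wc)) subrr.
move=> u v w uc vc wc; apply/eqP; rewrite -subr_eq0 opprD opprK addrACA.
rewrite -mulrBr [X in _ + X]addrC -opprB -mulrBl Gb //.
by rewrite mulrN (bil_central_comm a (central_bracket v u) wc) addNr.
Qed.

(** The conjugate - star (G (dag x) (dag y) (dag z)) is again a solution, its sign matching those in
    [der_dag] and [bracket_dag]; uniqueness identifies it with G. *)
Lemma koszul_star G : koszul G ->
  forall x y z, central x -> central y -> central z ->
  G (dag x) (dag y) (dag z) = - star (G x y z).
Proof.
move=> Gk x y z xc yc zc; apply/eqP; rewrite -eqr_oppLR; apply/eqP.
apply: (can_inj starK); rewrite starK starN.
apply/esym/(koszul_uniq Gk (G' := fun x y z => - star (G (dag x) (dag y) (dag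
  z)))) => //.
case: Gk => Ga Gb; split=> u v w uc vc wc;
  have [[uc' vc'] wc'] := (central_dag uc, central_dag vc, central_dag wc).
  by rewrite -opprD -starD Ga // bil_dag der_dag // starN starK opprK bilC.
rewrite opprK addrC -starN -starD -opprB starN Gb // bracket_dag // bilNl starN.
by rewrite opprK bil_dag starK bilC.
Qed.

(** * Linearity of the contractions and of the exterior derivative *)

Lemma hip_l_bal w : balanced (fun u v : Om => dag v :* hip u w).
Proof.
split=> *; rewrite ?hipDl ?ractDr ?dagD ?ractDl //.
by rewrite dagZl ractA -hipS hipZ starM hipS.
Qed.

Lemma hip0l w : hip (0 : Om) w = 0.
Proof. by rewrite -[0]dagK -/(bil _ _) dag0 bil0l. Qed.

Lemma hip0r w : hip w (0 : Om) = 0.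
Proof. by rewrite -[w]dagK -/(bil _ _) bil0r. Qed.

Lemma hipZl u v a : hip (u :* a : Om) v = star a * hip u v.
Proof. by rewrite -hipS hipZ starM hipS. Qed.

Lemma hip_rD w t t' : hip_r w (t + t') = hip_r w t + hip_r w t'.
Proof. exact: (tens_liftD (hip_r_bal w)). Qed.

Lemma hip_r0 w : hip_r w 0 = 0.
Proof. exact: (tens_lift0 (hip_r_bal w)). Qed.

Lemma hip_rE w u v : hip_r w (u *t v) = hip w u *: v.
Proof. exact: (tens_liftE (hip_r_bal w)). Qed.

Lemma hip_lD w t t' : hip_l (t + t') w = hip_l t w + hip_l t' w.
Proof. exact: (tens_liftD (hip_l_bal w)). Qed.

Lemma hip_l0 w : hip_l 0 w = 0.
Proof. exact: (tens_lift0 (hip_l_bal w)). Qed.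

Lemma hip_lE w u v : hip_l (u *t v) w = dag v :* hip u w.
Proof. exact: (tens_liftE (hip_l_bal w)). Qed.

Lemma hip_r_ract w t a : hip_r w (t :* a) = hip_r w t :* a.
Proof.
elim/(@tens_ind A Om Om): t => [|t u IHt IHu|p q].
- by rewrite ract0l hip_r0 ract0l.
- by rewrite ractDl !hip_rD ractDl IHt IHu.
- by rewrite tens_ractE !hip_rE bimodA.
Qed.

Lemma hip_l_ract w t a : hip_l (t :* a) w = star a *: hip_l t w.
Proof.
elim/(@tens_ind A Om Om): t => [|t u IHt IHu|p q].
- by rewrite ract0l hip_l0 scaler0.
- by rewrite ractDl !hip_lD scalerDr IHt IHu.
- by rewrite tens_ractE !hip_lE dagZr bimodA.
Qed.

Lemma hip_rDl w w' t : hip_r (w + w') t = hip_r w t + hip_r w' t.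
Proof.
elim/(@tens_ind A Om Om): t => [|t u IHt IHu|p q].
- by rewrite !hip_r0 addr0.
- by rewrite !hip_rD IHt IHu addrACA.
- by rewrite !hip_rE hipDl scalerDl.
Qed.

Lemma hip_rZl w t a : hip_r (w :* a) t = star a *: hip_r w t.
Proof.
elim/(@tens_ind A Om Om): t => [|t u IHt IHu|p q].
- by rewrite !hip_r0 scaler0.
- by rewrite !hip_rD scalerDr IHt IHu.
- by rewrite !hip_rE hipZl scalerA.
Qed.

Lemma hip_r0l t : hip_r 0 t = 0.
Proof. by rewrite -[X in hip_r X _](ract0r (0 : Om)) hip_rZl star0 scale0r. Qed.

Lemma hip_lDr w w' t : hip_l t (w + w') = hip_l t w + hip_l t w'.
Proof.
elim/(@tens_ind A Om Om): t => [|t u IHt IHu|p q].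
- by rewrite !hip_l0 addr0.
- by rewrite !hip_lD IHt IHu addrACA.
- by rewrite !hip_lE hipDr ractDr.
Qed.

Lemma hip_lZr w t a : hip_l t (w :* a) = hip_l t w :* a.
Proof.
elim/(@tens_ind A Om Om): t => [|t u IHt IHu|p q].
- by rewrite !hip_l0 ract0l.
- by rewrite !hip_lD ractDl IHt IHu.
- by rewrite !hip_lE hipZ ractA.
Qed.

Lemma hip_l0r t : hip_l t 0 = 0.
Proof. by rewrite -[X in hip_l _ X](ract0r (0 : Om)) hip_lZr ract0r. Qed.

Lemma dd0 : dd Om 0 = 0.
Proof. by rewrite -(scale0r (1 : A)) ddZ scale0r scale0r. Qed.

Lemma Psi_ract t a : Psi (t :* a) = Psi t :* a.
Proof.
have [[_ _ sr] _ _] := sigma_can Om.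
by rewrite /Psi /psi_of sr -ractDl bimodA.
Qed.

Lemma Psi0 : Psi (0 : T2 Om) = 0.
Proof. by rewrite -[X in Psi X](ract0r (0 : T2 Om)) Psi_ract ract0r. Qed.

Lemma PsiN t : Psi (- t) = - Psi t.
Proof. by apply: (addIr (Psi t)); rewrite -PsiD !addNr Psi0. Qed.

Lemma dPsiD u v : dPsi (u + v) = dPsi u + dPsi v.
Proof.
rewrite -[u]form_repK -[v]form_repK -form_sum_cat !dPsiE.
by rewrite dform_sum_cat PsiD opprD addrACA.
Qed.

Lemma dPsi_ract u a : dPsi (u :* a) =
  dPsi u :* a - (u *t dd Om a - Psi (u *t dd Om a)).
Proof.
pose s := form_rep u; rewrite -[u]form_repK -/s form_sum_ract !dPsiE.
have -> : dform_sum Om ([seq (p.1, p.2 * a) | p <- s] ++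
           [seq (- (p.1 * p.2), a) | p <- s]) =
          dform_sum Om s :* a - form_sum Om s *t dd Om a.
  rewrite dform_sum_cat /dform_sum !big_map ract_suml /form_sum.
  rewrite (big_morph (fun w => w *t dd Om a : T2 Om)
    (fun _ _ => tenspDl _ _ _) (tens0p _ _)) -sumrN -!big_split.
  apply: eq_bigr => p _ /=.
  rewrite ddN !ddM tenspNl tenspDl tenspDr tens_ractE tenspA opprD.
  by rewrite addrA addrK.
rewrite PsiD Psi_ract PsiN ractDl ractNl opprD opprK addrACA opprB.
by congr (_ + _); rewrite addrC.
Qed.

Lemma dPsi0 : dPsi (0 : Om) = 0.
Proof.
rewrite -[X in dPsi X](ract0r (0 : Om)) dPsi_ract tens0p ract0r Psi0.
by rewrite !subrr.
Qed.

Lemma bil_hip_l x v t : central x ->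
  bil x (hip_l t v) = star (tpair (dag v) t (dag x)).
Proof.
move=> xc; have xc' := central_dag xc.
elim/(@tens_ind A Om Om): t => [|t u IHt IHu|p q].
- by rewrite tpair0 // /hip_l (tens_lift0 (hip_l_bal v)) bil0r star0.
- by rewrite tpairD // /hip_l (tens_liftD (hip_l_bal v)) bilDr starD IHt IHu.
- rewrite tpairE // /hip_l (tens_liftE (hip_l_bal v)) bilZr starM.
  by rewrite -{1}[x]dagK bil_dag (bilC _ xc') {3}/bil dagK hipS.
Qed.

(** * Levi-Civita connections and the Koszul identities *)

Section Connection.
Variable nabla : Om -> T2 Om.

(** The second leg of [nabla y] carries the differential, so x is the direction of differentiation
    and z the test form. *)
Definition christoffel x y z : A := tpair z (nabla y) x.

Lemma lc_koszul : levi_civita nabla -> koszul christoffel.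
Proof.
move=> [_ herm tors sd]; rewrite /christoffel.
(* The sigma-dagger condition: [sigma] exchanges the slots, the conjugate connection brings the
   star. *)
have sE x y z : central x -> central z ->
    tpair x (nabla y) z = - star (tpair (dag x) (nabla (dag y)) (dag z)).
  move=> xc zc; rewrite -tpair_sigma // sd /conj_connection tpairN //
    tpair_tdag //.
(* The Hermitian condition at [dag z] and y, where [sE] removes the star. *)
have Ga x y z : central x -> central y -> central z ->
    tpair z (nabla y) x + tpair y (nabla z) x = der x (bil y z).
  move=> xc yc zc; have := congr1 (bil x) (herm (dag z) y).
  rewrite bilDr bilNr bil_hip_l // bil_hip_r // dagK -sE // addrC.
  by rewrite /der (bilC z yc).
split=> // x y z xc yc zc.
(* Torsion-freeness fixes the part of [nabla v] antisymmetric in its legs; it is doubled to clear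
   the half in [Psi]. *)
have T u v w : central u -> central w ->
    tpair w (nabla v) u - tpair u (nabla v) w =
    der u (bil w v) - der w (bil u v) + bil (bracket w u) v.
  move=> uc wc; have /eqP := congr1 (fun t => tpair w t u) (tors v).
  rewrite tpair0 // tpairD // tpairD // tpairN // tpair_Psi // addr_eq0.
  move=> /eqP E.
  have := congr1 (fun a => a + a) E.
  rewrite addrACA -opprD half_scalarDl addrKA => ->.
  by rewrite -opprD dPsi_pair // !opprB addrC.
have {}T := T x z y xc yc.
(* The metric identity turns both terms into contractions of [nabla z], whose difference is [T]. *)
have -> : tpair z (nabla y) x = der x (bil y z) - tpair y (nabla z) x.
  by rewrite -Ga // addrK.
have -> : tpair z (nabla x) y = der y (bil x z) - tpair x (nabla z) y.
  by rewrite -Ga // addrK.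
rewrite opprD opprK addrACA [X in _ + X]addrC -[tpair x _ y - _]opprB T.
by rewrite opprD addrA subrr add0r bracketN // bilNl opprK.
Qed.

(** Each condition spreads from central forms by additivity and the Leibniz rule. On central forms,
    [koszul_star] removes the star from the Hermitian and sigma-dagger conditions; the latter also
    uses [koszul_comm] to move the coefficient across. *)
Lemma koszul_lc : right_connection nabla -> koszul christoffel ->
  levi_civita nabla.
Proof.
move=> nablaR nK; have [nD _ nZ] := nablaR; have [Ga Gb] := nK.
have n0 : nabla 0 = 0.
  by apply: (addIr (nabla 0)); rewrite -nD !add0r.
split=> //.
- elim/central_ind => [v|u u' IH IH' v|u a uc].
  + by rewrite n0 hip_l0 hip0l dd0 hip_r0l oppr0 addr0.
  + by rewrite nD hip_lD hip_rDl hipDl ddD -IH -IH' opprD addrACA.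
  elim/central_ind => [|v v' IH IH'|v b vc].
  + by rewrite n0 hip_r0 hip0r dd0 hip_l0r oppr0 addr0.
  + by rewrite nD hip_rD hip_lDr hipDr ddD -IH -IH' opprD addrACA.
  have H : - hip_l (nabla u) v + hip_r u (nabla v) = dd Om (hip u v).
    apply: bil_central_inj => x xc.
    have [[uc' vc'] xc'] := (central_dag uc, central_dag vc, central_dag xc).
    rewrite bilDr bilNr bil_hip_l // bil_hip_r //.
    have := koszul_star nK xc uc' vc; rewrite /christoffel dagK => ->.
    rewrite starN opprK starK addrC.
    have := Ga x v (dag u) xc vc uc'; rewrite /christoffel => ->.
    by rewrite (bilC _ vc) /bil dagK.
  have Hb : - hip_l (nabla u) (v :* b) + hip_r u (nabla (v :* b)) =
      dd Om (hip u (v :* b)).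
    rewrite hip_lZr nZ hip_rD hip_r_ract hip_rE hipZ ddM -H ractDl ractNl.
    by rewrite addrA.
  rewrite [nabla (u :* a)]nZ hip_lD hip_l_ract hip_lE hip_rZl hipZl.
  rewrite ddM -Hb dd_star ractNl scalerDr scalerN opprD.
  by rewrite [- _ - _]addrC addrA.
- elim/central_ind => [|u v IH IH'|y a yc].
  + by rewrite n0 Psi0 dPsi0 subrr addr0.
  + by rewrite nD PsiD dPsiD opprD [X in X + _]addrACA [LHS]addrACA IH IH'
      addr0.
  have Ty : (nabla y - Psi (nabla y)) + dPsi y = 0.
    apply: T2_sep => z x zc xc; rewrite tpair0 // tpairD // tpairD // tpairN //
      tpair_Psi //.
    apply: addrr_inj; rewrite addr0 addrACA dPsi_pair //.
    rewrite [X in X + _]addrACA -opprD half_scalarDl addrKA.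
    have E1 := Ga x y z xc yc zc; have E2 := Ga z x y zc xc yc.
    have E3 := Gb x z y xc zc yc; rewrite /christoffel in E1 E2 E3.
    have -> : tpair z (nabla y) x = der x (bil y z) - tpair y (nabla z) x.
      by rewrite -E1 addrK.
    have -> : tpair x (nabla y) z = der z (bil x y) - tpair y (nabla x) z.
      by rewrite -E2 [X in X - _]addrC addrK.
    rewrite opprD opprK [X in X + _]addrACA [- tpair y _ x + _]addrC.
    rewrite -[tpair y (nabla x) z - _]opprB E3.
    rewrite (bracketN xc zc) bilNl opprK (bilC z yc) addrACA addNr addr0.
    by rewrite addrA subrK subrr.
  rewrite nZ PsiD Psi_ract dPsi_ract [- (_ :* _ + _)]opprD.
  rewrite [X in X + _ = _]addrACA.
  by rewrite [LHS]addrACA subrr addr0 -ractNl -!ractDl Ty ract0l.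
- move=> w; rewrite /conj_connection.
  have [[sD _ sr] _ sE] := sigma_can Om.
  have s0 : sigma (c := Om) 0 = 0 by rewrite -[X in sigma X](ract0r (0 : T2
    Om)) sr ract0r.
  elim/central_ind: w => [|u v IH IH'|y a yc].
  + by rewrite dag0 n0 tdag0 s0 oppr0.
  + by rewrite dagD !nD tdagD sD IH IH' opprD.
  have yc' := central_dag yc.
  rewrite dagZr yc' !nZ sD sr sE; last by left.
  rewrite tdagD tdagZr starK tdagE dagK dd_star dagN dagK opprD tenspNl opprK.
  congr (_ + _); apply: T2_sep => z x zc xc.
  have [zc' xc'] := (central_dag zc, central_dag xc).
  rewrite tpair_ract // tpairN // tpair_lact // tpair_tdag // tpair_sigma //.
  have := koszul_star nK zc yc xc; rewrite /christoffel => ->.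
  by rewrite starN starK mulrN opprK (koszul_comm nK).
Qed.
End Connection.

(** * Existence of the Levi-Civita connection *)

(** The Koszul formula for nabla_x y. The two contractions carry no factor 1/2 because [dPsi]
    already contains it. *)
Definition koszul_form x y : Om :=
  half_scalar *: (dd Om (bil x y) + bracket x y) + hip_r (dag x) (dPsi y)
  + hip_r (dag y) (dPsi x).

Lemma bil_koszul_form x y z : central z -> bil (koszul_form x y) z =
  half_scalar * (der z (bil x y) + bil (bracket x y) z) + tpair x (dPsi y) z +
    tpair y (dPsi x) z.
Proof.
move=> zc; rewrite -(bilC _ zc) !bilDr bil_centralZ // bilDr !bil_hip_r //.
by rewrite !dagK (bilC (bracket x y) zc).
Qed.

(** In the sum, the contractions of [dPsi x] cancel by antisymmetry and Cartan's formula turns the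
    rest into x(<y, z>). In the difference, everything but the bracket is symmetric in x and y. *)
Lemma koszul_koszul_form : koszul (fun x y z => bil (koszul_form x y) z).
Proof.
have dE x y z : central x -> central z -> tpair x (dPsi y) z =
    half_scalar * (der x (bil z y) - der z (bil x y) - bil (bracket x z) y).
  by move=> xc zc; rewrite -dPsi_pair // mulrDr half_scalarDl.
split=> x y z xc yc zc; rewrite !bil_koszul_form //.
  have anti : tpair y (dPsi x) z + tpair z (dPsi x) y = 0.
    rewrite !dE // -mulrDr (bracketN yc zc) bilNl opprK addrACA addNr addr0.
    by rewrite addrA subrK subrr mulr0.
  rewrite addrACA anti addr0 !dE // addrACA -!mulrDr.
  rewrite (bilC y zc).
  set p := der z _; set q := der y _; set r := der x _.
  set b := bil _ z; set c := bil _ y.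
  have -> : p + b + (q + c) = (p + c) + (q + b).
    by rewrite [q + c]addrC addrACA [b + q]addrC.
  rewrite addrACA -![r - _ - _]addrA -!opprD ![_ + (r - _)]addrC !subrK.
  by rewrite mulrDr half_scalarDl.
rewrite (bilC x yc) (bracketN xc yc) bilNl [X in _ - X]addrAC opprD addrACA
  subrr addr0.
rewrite opprD addrACA subrr addr0 -mulrBr opprD opprK addrACA subrr add0r.
by rewrite mulrDr half_scalarDl.
Qed.

Lemma koszul_form_ext y : central y ->
  exists2 F : Om -> Om, rmod_hom F & forall x, central x -> F x = koszul_form x
    y.
Proof.
move=> yc.
have [|s sc s0|F FE] := @central_ext Om (fun x a => koszul_form x y :* a).
- by move=> x a _; rewrite ractNr.
- apply: bil_central_inj => z zc; rewrite bil0r bil_sumr.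
  (* W does not depend on x, and [bil W x] is right-linear in x, so relations are respected. It
     arises by exchanging x and y through the torsion identity, then x and z through the metric one;
     the bracket is absorbed by Cartan's formula for [dPsi z]. *)
  pose W := hip_r (dag y) (dPsi z) + hip_r (dag y) (dPsi z)
            + dd Om (bil y z) - koszul_form y z.
  have WE x : central x -> bil (koszul_form x y) z = bil W x.
    move=> xc; have [Ka Kb] := koszul_koszul_form.
    have -> : bil (koszul_form x y) z = bil (koszul_form y x) z - bil (bracket
      y x) z.
      by rewrite -Kb // opprB addrC subrK.
    have -> : bil (koszul_form y x) z = der y (bil x z) - bil (koszul_form y z)
      x.
      by rewrite -Ka // addrK.
    rewrite -(bilC W xc) /W !bilDr bilNr bil_hip_r // dagK dPsi_pair //.
    rewrite -/(der x _) (bilC (koszul_form y z) xc) [LHS]addrAC.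
    by congr (_ - _); rewrite -[LHS](subrK (der x (bil y z))) [_ - bil _ z -
      _]addrAC.
  rewrite big_seq.
  under eq_bigr => p /sc pc do rewrite bilZr (bilC _ zc) WE // -bilZr.
  by rewrite -big_seq -bil_sumr -[X in bil W X]/(act_sum s) s0 bil0r.
exists F.
  split=> [u v|u a].
    have [s sc ->] := act_sumP u; have [s' sc' ->] := act_sumP v.
    by rewrite -act_sum_cat (FE _ (central_seq_cat sc sc')) !FE // big_cat.
  have [s sc ->] := act_sumP u.
  rewrite -act_sum_ract (FE _ (@central_seq_map s ( *%R^~ a) sc)) FE //.
  rewrite big_map ract_suml; apply: eq_bigr => p _.
  by rewrite ractA.
move=> x xc; have := FE [:: (x, 1)].
rewrite /act_sum !big_seq1 /= !ract1; apply => p.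
by rewrite inE => /eqP->.
Qed.

(** The adjoint of the expansion [ef]: expand [dag z] in [hip w (dag z)] and apply [star]. *)
Lemma dual_frame n (e f : 'I_n -> Om) :
  (forall w, w = \sum_i e i :* hip (f i) w) ->
  forall w, w = \sum_i f i :* hip (e i) w.
Proof.
move=> ef w; apply: bil_central_inj => z zc.
have -> : bil z w = star (hip w (dag z)) by rewrite hipS.
rewrite [dag z]ef bil_sumr.
have hD : {morph hip w : u v / u + v} by move=> u v; rewrite hipDr.
rewrite (big_morph _ hD (hip0r w)).
have sD : {morph star : a b / a + b : A} by move=> a b; apply: starD.
rewrite (big_morph _ sD star0); apply: eq_bigr => i _.
by rewrite hipZ starM !hipS bilZr.
Qed.

(** Centrality of y stands under the existential so that [choice] yields a function on all forms. *)
Lemma christoffel_exists y : exists t, central y ->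
  forall x z, central x -> central z -> tpair z t x = bil (koszul_form x y) z.
Proof.
have [yc|nyc] := pselect (central y); last by exists 0.
have [F [FD FZ] FE] := koszul_form_ext yc; have [n [e [f ef]]] := frame Om.
have F0 : F 0 = 0 by apply: (addIr (F 0)); rewrite -FD !add0r.
(* Contracting the second leg with x gives F applied to the [dual_frame] expansion of x. *)
exists (\sum_i F (f i) *t dag (e i)) => _ x z xc zc.
rewrite tpair_sum // -FE // -(bilC _ zc) [X in F X](dual_frame ef).
rewrite (big_morph _ FD F0) bil_sumr; apply: eq_bigr => i _.
by rewrite tpairE // FZ bilZr (bilC _ xc) /bil dagK.
Qed.

(** The Leibniz rule dictates the value on y :* a. Contracted with z and x it equals x(<z, y a>) -
    <koszul_form x z, y a>, which is additive in the form y a; hence relations are respected. *)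
Lemma right_connection_exists : exists nabla : Om -> T2 Om,
  right_connection nabla /\
  forall x y z, central x -> central y -> central z ->
    christoffel nabla x y z = bil (koszul_form x y) z.
Proof.
have [N NE] := choice christoffel_exists.
have [|s sc s0|D DE] :=
    @central_ext (T2 Om) (fun y a => N y :* a + y *t dd Om a).
- by move=> y a _; rewrite ractNr ddN opprD -[- dd Om a]scaleN1r -tenspA ractNr
    ract1 tenspNl.
- apply: T2_sep => z x zc xc; rewrite tpair0 // tpair_sum // big_seq.
  have [Ka _] := koszul_koszul_form.
  rewrite (eq_bigr (fun p : Om * A =>
      der x (bil z p.1 * p.2) - bil (koszul_form x z) (p.1 :* p.2))); last
        first.
    move=> p /sc pc; rewrite tpairD // tpair_ract // tpairE // NE // bilZr
      -(bilC _ zc).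
    rewrite derM // -/(der _ _) addrAC; congr (_ + _).
    by rewrite (bilC _ zc) -mulrBl (bilC _ zc) -Ka // addrK.
  rewrite -big_seq sumrB -(big_morph _ (derD x) (der0 x)) -[X in _ - X]bil_sumr.
  under eq_bigr do rewrite -bilZr.
  by rewrite -bil_sumr -![\sum_(p <- s) _]/(act_sum s) s0 !bil0r der0 subrr.
have DZ u a : D (u :* a) = D u :* a + u *t dd Om a.
  have [s sc ->] := act_sumP u.
  rewrite -act_sum_ract (DE _ (@central_seq_map s ( *%R^~ a) sc)) DE //.
  rewrite big_map ract_suml /act_sum.
  rewrite (big_morph (fun w => w *t dd Om a : T2 Om)
    (fun _ _ => tenspDl _ _ _) (tens0p _ _)) -big_split.
  apply: eq_bigr => p _ /=.
  by rewrite ddM tenspDr ractDl ractA tens_ractE tenspA addrA.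
exists D; split.
  split=> // [u v|c u].
    have [s sc ->] := act_sumP u; have [s' sc' ->] := act_sumP v.
    by rewrite -act_sum_cat (DE _ (central_seq_cat sc sc')) !DE // big_cat.
  (* Complex linearity is the Leibniz rule for a scalar, whose differential vanishes. *)
  rewrite bimod_scalar DZ dd_scalar tensp0 addr0.
  elim/(@tens_ind A Om Om): (D u) => [|t t' IH IH'|p q].
  - by rewrite ract0l scaler0.
  - by rewrite ractDl scalerDr IH IH'.
  - by rewrite tens_ractE tens_lactE -bimod_scalar -tenspA -bimod_scalar.
move=> x y z xc yc zc; rewrite /christoffel -NE //; congr tpair.
have := DE [:: (y, 1)].
rewrite /act_sum !big_seq1 /= !ract1 dd1 tensp0 addr0; apply => p.
by rewrite inE => /eqP->.
Qed.

Lemma koszul_eq G G' :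
  (forall x y z, central x -> central y -> central z -> G x y z = G' x y z) ->
  koszul G' -> koszul G.
Proof. by move=> GG' [Ka Kb]; split=> x y z xc yc zc; rewrite !GG' // ?Ka ?Kb.
  Qed.

Lemma levi_civita_unique (nabla nabla' : Om -> T2 Om) :
  levi_civita nabla -> levi_civita nabla' -> nabla = nabla'.
Proof.
move=> nL nL'; have [[[nD _ nZ] _ _ _] [[nD' _ nZ'] _ _ _]] := (nL, nL').
have n0 : nabla 0 = 0 by apply: (addIr (nabla 0)); rewrite -nD !add0r.
have n0' : nabla' 0 = 0 by apply: (addIr (nabla' 0)); rewrite -nD' !add0r.
apply/funext; elim/central_ind => [|u v IH IH'|y a yc].
- by rewrite n0 n0'.
- by rewrite nD nD' IH IH'.
rewrite nZ nZ'; congr (_ :* _ + _); apply: T2_sep => z x zc xc.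
exact: (koszul_uniq (lc_koszul nL) (lc_koszul nL')).
Qed.

Lemma levi_civita_exists : exists nabla : Om -> T2 Om, levi_civita nabla.
Proof.
have [nabla [nR nE]] := right_connection_exists.
exists nabla; apply: koszul_lc => //; exact: koszul_eq nE koszul_koszul_form.
Qed.

(** * Musical isomorphisms and Hermitian derivations *)

Lemma lsharpE w v : lsharp w v = bil v w. Proof. by []. Qed.

Lemma lsharpD u v : lsharp (u + v) = lsharp u + lsharp v.
Proof. by apply/val_inj/funext => w; apply: bilDr. Qed.

Lemma lsharpZ u a : lsharp (u :* a) = lsharp u :* a.
Proof. by apply/val_inj/funext => w; apply: bilZr. Qed.

Lemma rsharpD u v : rsharp (u + v) = rsharp u + rsharp v.
Proof. by apply/val_inj/funext => w; apply: bilDl. Qed.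

Lemma rsharpZ a u : rsharp (a *: u) = a *: rsharp u.
Proof. by apply/val_inj/funext => w; apply: bilZl. Qed.

Lemma lsharpK : cancel (lsharp (Om := Om)) (lflat (Om := Om)).
Proof.
move=> w; have [u [_ uU]] := lsharp_bij (lsharp w).
by rewrite -(uU _ (lflatK _)) (uU w).
Qed.

Lemma rsharpK : cancel (rsharp (Om := Om)) (rflat (Om := Om)).
Proof.
move=> w; have [u [_ uU]] := rsharp_bij (rsharp w).
by rewrite -(uU _ (rflatK _)) (uU w).
Qed.

Lemma lvf_hip_lsharp u v : lvf_hip (lsharp u) (lsharp v) = hip u v.
Proof. by rewrite /lvf_hip !lsharpK. Qed.

Lemma lflatD (X Y : lvf Om) : lflat (X + Y) = lflat X + lflat Y.
Proof. by rewrite -{1}[X]lflatK -{1}[Y]lflatK -lsharpD lsharpK. Qed.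

Lemma lflatZ (X : lvf Om) a : lflat (X :* a) = lflat X :* a.
Proof. by rewrite -{1}[X]lflatK -lsharpZ lsharpK. Qed.

Lemma phi_l_der x : central x -> phi_l Om (der x) = lsharp x.
Proof.
move=> xc; apply/val_inj/funext => w.
exact: etrans (phi_der w xc) (bilC w xc).
Qed.

Lemma phi_r_der x : central x -> phi_r Om (der x) = rsharp x.
Proof. by move=> xc; apply/val_inj/funext => w; apply: phi_der. Qed.

Lemma DC_derP del : DC Om del -> exists2 x : Om, central x & del = der x.
Proof.
move=> delD; exists (der_form del); first exact: central_der_form.
by apply/funext => a; rewrite der_formK.
Qed.

Lemma central0 : central (0 : Om).
Proof. by move=> a; rewrite scaler0 ract0l. Qed.

Lemma central_scale (c : R[i]) x : central x -> central ((c%:A : A) *: x).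
Proof. by apply: centralZ => b; apply: scalar_comm. Qed.

Lemma der_add x y : (fun a => der x a + der y a) = der (x + y).
Proof. by apply/funext => a; rewrite /der bilDl. Qed.

Lemma der_scale (c : R[i]) x : (fun a => c *: der x a) = der ((c%:A : A) *: x).
Proof. by apply/funext => a; rewrite /der bilZl -scalerAl mul1r. Qed.

Lemma der_bracket x y : central x -> central y ->
  lie_bracket (der x) (der y) = der (bracket x y).
Proof. by move=> xc yc; apply/funext => a; rewrite der_bracketE. Qed.

Lemma DC_lie : complex_lie_subalgebra (DC Om).
Proof.
split.
- by move=> del [].
- rewrite (_ : (fun=> 0) = der (0 : Om)); first exact/DC_der/central0.
  by apply/funext => a; rewrite /der bil0l.
- move=> _ _ /DC_derP[x xc ->] /DC_derP[y yc ->]; rewrite der_add.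
  exact/DC_der/centralD.
- by move=> c _ /DC_derP[x xc ->]; rewrite der_scale;
    apply/DC_der/central_scale.
- move=> _ _ /DC_derP[x xc ->] /DC_derP[y yc ->]; exact: DC_bracket.
Qed.

(** Hermitian derivations correspond to anti-Hermitian forms, owing to the sign in [dd_star]. *)
Lemma herm_derP del : hermitian_part (DC Om) del ->
  exists x : Om, [/\ central x, dag x = - x & del = der x].
Proof.
move=> [/DC_derP[x xc ->] xh]; exists x; split=> //.
apply: der_inj; [exact: central_dag|exact: centralN|move=> a].
by rewrite -{1}[a]starK der_dag // xh /der bilNl.
Qed.

Lemma herm_der x : central x -> dag x = - x -> hermitian_part (DC Om) (der x).
Proof.
move=> xc xN; split=> [|a]; first exact: DC_der.
have := der_dag (star a) xc; rewrite starK xN [LHS]bilNl => /oppr_inj E.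
by rewrite -E.
Qed.

(** The Cartesian decomposition y = (x - dag x)/2, z = i (x + dag x)/2, c = -i; it makes the
    anti-Hermitian central forms generate. *)
Lemma herm_split x : central x -> exists (y z : Om) (c : A),
  [/\ central y /\ dag y = - y, central z /\ dag z = - z & x = y + z :* c].
Proof.
move=> xc; have xc' := central_dag xc.
have conj_i : conjc ('i : R[i]) = - 'i.
  by apply/eqP; rewrite eq_complex /= oppr0 !eqxx.
have conj_half : conjc (2%:R^-1 : R[i]) = 2%:R^-1.
  by rewrite fmorphV rmorph_nat.
exists (half_scalar *: (x - dag x)), (('i%:A : A) *: (half_scalar *: (x + dag
  x))), ((- 'i)%:A : A).
split.
- split; first exact/central_scale/centralD/centralN.
  by rewrite dagZ conj_half dagD dagN dagK -scalerN opprB addrC.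
- split; first exact/central_scale/central_scale/centralD.
  by rewrite !dagZ conj_half conj_i dagD dagK scaleNr scaleNr [dag x + x]addrC.
rewrite -bimod_scalar !scalerA mulrA -[(- 'i)%:A * _]scalerAl mul1r scalerA.
rewrite mulNr -expr2 sqr_i opprK scale1r mul1r -scalerDr [x + dag x]addrC addrA
  subrK.
by rewrite scalerDr -scalerDl half_scalarD scale1r.
Qed.

Lemma anti_act_sumP w : exists s : seq (Om * A),
  (forall p, p \in s -> central p.1 /\ dag p.1 = - p.1) /\ w = act_sum s.
Proof.
elim/central_ind: w => [|u v [s [sP ->]] [s' [sP' ->]]|x a xc].
- by exists [::]; rewrite /act_sum big_nil.
- exists (s ++ s'); rewrite act_sum_cat; split=> // p.
  by rewrite mem_cat => /orP[/sP|/sP'].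
have [y [z [c [yP zP ->]]]] := herm_split xc.
exists [:: (y, a); (z, c * a)]; split.
  by move=> p; rewrite !inE => /orP[]/eqP->.
by rewrite /act_sum big_cons big_seq1 /= ractDl ractA.
Qed.

Lemma phi_l_gen (U : lvf Om) : exists n (del : 'I_n -> A -> A) (a : 'I_n -> A),
  (forall i, hermitian_part (DC Om) (del i)) /\
  U = \sum_i phi_l Om (del i) :* a i.
Proof.
have [s [sP sE]] := anti_act_sumP (lflat U).
exists (size s), (fun i => der (tnth (in_tuple s) i).1),
  (fun i => (tnth (in_tuple s) i).2).
have tP i := sP _ (mem_tnth i (in_tuple s)).
split=> [i|]; first by apply: herm_der; have [] := tP i.
have ls0 : lsharp (0 : Om) = 0 by apply/val_inj/funext => w; apply: bil0r.
rewrite -[U]lflatK sE /act_sum (big_morph _ lsharpD ls0) big_tnth.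
apply: eq_bigr => i _; rewrite lsharpZ phi_l_der //.
by have [] := tP i.
Qed.

Lemma tpairNr z t x : central x -> tpair z t (- x) = - tpair z t x.
Proof.
move=> xc; have xc' := centralN xc.
elim/(@tens_ind A Om Om): t => [|t u IHt IHu|u v].
- by rewrite !tpair0 // oppr0.
- by rewrite !tpairD // IHt IHu opprD.
- by rewrite !tpairE // bilNl mulrN.
Qed.

(** * The induced connection and the right calculus *)

Section Induced.
Variable nabla : Om -> T2 Om.
Hypothesis nablaL : levi_civita nabla.

Let nablaR : right_connection nabla. Proof. by case: nablaL. Qed.
Let nablaK : koszul (christoffel nabla). Proof. exact: lc_koszul. Qed.
Let nablal := nabla_lvf (conj_connection nabla).

Lemma nabla_lvf_der x (U : lvf Om) w : central x -> nablal (der x) U w =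
  der x (U w) - vf_pair (bil x) (conj_connection nabla w) U.
Proof.
move=> xc; rewrite /nablal nabla_lvfE //; last exact: DC_der.
by rewrite (_ : bvf_fun _ = bil x) //; apply/funext => v; apply: phi_der.
Qed.

Lemma vf_pairDr x t (U V : lvf Om) :
  vf_pair (bil x) t (U + V) = vf_pair (bil x) t U + vf_pair (bil x) t V.
Proof.
have xl := bil_right_linear x.
have [[Ul Vl] UVl] := (lvf_linear U, lvf_linear V, lvf_linear (U + V)).
elim/(@tens_ind A Om Om): t => [|t u IHt IHu|p q].
- by rewrite !vf_pair0 // addr0.
- by rewrite !vf_pairD // IHt IHu addrACA.
- by rewrite !vf_pairE // -mulrDr.
Qed.

Lemma vf_pair_act x t (U : lvf Om) a :
  vf_pair (bil x) t (U :* a) = vf_pair (bil x) t U * a.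
Proof.
have xl := bil_right_linear x.
have [Ul Ual] := (lvf_linear U, lvf_linear (U :* a)).
elim/(@tens_ind A Om Om): t => [|t u IHt IHu|p q].
- by rewrite !vf_pair0 // mul0r.
- by rewrite !vf_pairD // IHt IHu mulrDl.
- by rewrite !vf_pairE // -mulrA.
Qed.

Lemma vf_pair_bilD x y t (U : lvf Om) :
  vf_pair (bil (x + y)) t U = vf_pair (bil x) t U + vf_pair (bil y) t U.
Proof.
have [[xl yl] xyl] :=
  (bil_right_linear x, bil_right_linear y, bil_right_linear (x + y)).
have Ul := lvf_linear U.
elim/(@tens_ind A Om Om): t => [|t u IHt IHu|p q].
- by rewrite !vf_pair0 // addr0.
- by rewrite !vf_pairD // IHt IHu addrACA.
- by rewrite !vf_pairE // bilDl mulrDl.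
Qed.

Lemma vf_pair_bilZ a x t (U : lvf Om) :
  vf_pair (bil (a *: x)) t U = a * vf_pair (bil x) t U.
Proof.
have [xl axl] := (bil_right_linear x, bil_right_linear (a *: x)).
have Ul := lvf_linear U.
elim/(@tens_ind A Om Om): t => [|t u IHt IHu|p q].
- by rewrite !vf_pair0 // mulr0.
- by rewrite !vf_pairD // IHt IHu mulrDr.
- by rewrite !vf_pairE // bilZl mulrA.
Qed.

Lemma vf_pair_lsharp x y t : central y ->
  vf_pair (bil x) t (lsharp y) = tpair x t y.
Proof.
move=> yc; rewrite /tpair; congr vf_pair.
by apply/funext => w; apply/esym/bilC.
Qed.

(** The sigma-dagger condition replaces the conjugate connection by the flipped [nabla], so the
    value at z is x(<y, z>) - Gamma(x, z, y) with Gamma the Christoffel coefficients, which is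
    Gamma(x, y, z) by the metric identity. Centrality of c is [koszul_comm]. *)
Lemma nabla_lsharp x y : central x -> central y -> exists c : Om,
  [/\ central c, nablal (der x) (lsharp y) = lsharp c
    & forall z, central z -> bil c z = christoffel nabla x y z].
Proof.
move=> xc yc; pose c := lflat (nablal (der x) (lsharp y)).
have cE z : central z -> bil z c = christoffel nabla x y z.
  move=> zc; rewrite -lsharpE lflatK nabla_lvf_der // vf_pair_lsharp //.
  have [_ _ _ sd] := nablaL; rewrite -sd tpair_sigma // lsharpE (bilC y zc).
  by have [<- // _] := nablaK; rewrite addrK.
exists c; split; last by move=> z zc; rewrite -(bilC _ zc) cE.
  move=> a; apply: bil_central_inj => z zc.
  rewrite bil_centralZ // bilZr cE //; exact: koszul_comm.
by rewrite lflatK.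
Qed.

Lemma christoffelN x y z : central x ->
  christoffel nabla (- x) (- y) z = christoffel nabla x y z.
Proof.
have [nD _ _] := nablaR.
have n0 : nabla 0 = 0 by apply: (addIr (nabla 0)); rewrite -nD !add0r.
move=> xc; rewrite /christoffel tpairNr // (_ : nabla (- y) = - nabla y).
  by rewrite tpairN // opprK.
by apply: (addIr (nabla y)); rewrite -nD !addNr.
Qed.

(** By [koszul_star], the form c of [nabla_lsharp] is anti-Hermitian when x and y are. The reality
    conditions on first and second covariant derivatives thereby reduce to [real_phi_l]. *)
Lemma nabla_phi_l del d : hermitian_part (DC Om) del ->
  hermitian_part (DC Om) d ->
  exists2 d', hermitian_part (DC Om) d' & nablal del (phi_l Om d) = phi_l Om d'.
Proof.
move=> /herm_derP[x [xc xN ->]] /herm_derP[y [yc yN ->]].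
have [c [cc cE cP]] := nabla_lsharp xc yc.
exists (der c); last by rewrite !phi_l_der.
apply: herm_der => //; apply: bil_central_inj => z zc.
have zc' := central_dag zc.
rewrite -[z in LHS]dagK bil_dag bilNr cP // -[LHS]opprK -koszul_star //.
by rewrite xN yN christoffelN // dagK -cP // (bilC _ zc).
Qed.

Lemma real_phi_l d1 d2 : hermitian_part (DC Om) d1 ->
  hermitian_part (DC Om) d2 ->
  selfadjoint (lvf_hip (phi_l Om d1) (phi_l Om d2)).
Proof.
move=> /herm_derP[x [xc xN ->]] /herm_derP[y [yc yN ->]].
rewrite !phi_l_der // lvf_hip_lsharp /selfadjoint hipS.
rewrite -[y in LHS]dagK -[x in RHS]dagK xN yN -!/(bil _ _) !bilNl.
by rewrite bilC.
Qed.

Lemma nabla_lvfD del U V : DC Om del -> nablal del (U + V) = nablal del U +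
  nablal del V.
Proof.
move=> /DC_derP[x xc ->]; apply/val_inj/funext => w.
rewrite -[LHS]/(nablal _ _ w) -[RHS]/(nablal _ _ w + nablal _ _ w)
  !nabla_lvf_der //.
by rewrite vf_pairDr derD opprD addrACA.
Qed.

Lemma nabla_lvf_act del U a : DC Om del ->
  nablal del (U :* a) = nablal del U :* a + U :* del a.
Proof.
move=> /DC_derP[x xc ->]; apply/val_inj/funext => w.
rewrite -[LHS]/(nablal _ _ w) -[RHS]/(nablal _ _ w * a + U w * der x a).
rewrite !nabla_lvf_der // vf_pair_act -[(U :* a) w]/(U w * a) derM //.
by rewrite mulrBl addrAC.
Qed.

Lemma lvf_hipDl (U V W : lvf Om) :
  lvf_hip (U + V) W = lvf_hip U W + lvf_hip V W.
Proof. by rewrite /lvf_hip lflatD hipDl. Qed.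

Lemma lvf_hipDr (U V W : lvf Om) :
  lvf_hip U (V + W) = lvf_hip U V + lvf_hip U W.
Proof. by rewrite /lvf_hip lflatD hipDr. Qed.

Lemma lvf_hipZ (U V : lvf Om) a : lvf_hip U (V :* a) = lvf_hip U V * a.
Proof. by rewrite /lvf_hip lflatZ hipZ. Qed.

Lemma lvf_hipS (U V : lvf Om) : star (lvf_hip U V) = lvf_hip V U.
Proof. exact: hipS. Qed.

Lemma lvf_hipZl (U V : lvf Om) a : lvf_hip (U :* a) V = star a * lvf_hip U V.
Proof. by rewrite -lvf_hipS lvf_hipZ starM lvf_hipS. Qed.

(** Both sides obey the same Leibniz rules in U and V, so central fields suffice. There
    [koszul_star] makes both terms Christoffel coefficients, and the claim is the metric identity at
    [dag y] and z. *)
Lemma nabla_metric del U V : hermitian_part (DC Om) del ->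
  del (lvf_hip U V) = lvf_hip (nablal del U) V + lvf_hip U (nablal del V).
Proof.
move=> /herm_derP[x [xc xN ->]].
have dx : DC Om (der x) by apply: DC_der.
have h0l (W : lvf Om) : lvf_hip 0 W = 0.
  by apply: (addIr (lvf_hip 0 W)); rewrite -lvf_hipDl !add0r.
have h0r (W : lvf Om) : lvf_hip W 0 = 0.
  by apply: (addIr (lvf_hip W 0)); rewrite -lvf_hipDr !add0r.
have ls0 : lsharp (0 : Om) = 0 by apply/val_inj/funext => w; apply: bil0r.
have nl0 : nablal (der x) 0 = 0.
  by apply: (addIr (nablal (der x) 0)); rewrite -nabla_lvfD // !add0r.
have star_der a : der x (star a) = star (der x a).
  by rewrite -[x in LHS]opprK -xN /der bilNl -/(der _ _) der_dag // opprK.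
rewrite -[U]lflatK -[V]lflatK; move: (lflat U) (lflat V) => {U V} u v.
elim/central_ind: u v => [v|u u' IH IH' v|y a yc].
- by rewrite ls0 nl0 !h0l der0 addr0.
- by rewrite lsharpD nabla_lvfD // !lvf_hipDl derD IH IH' addrACA.
elim/central_ind => [|v v' IH IH'|z b zc].
- by rewrite ls0 nl0 !h0r der0 addr0.
- by rewrite lsharpD nabla_lvfD // !lvf_hipDr derD IH IH' addrACA.
have M : der x (lvf_hip (lsharp y) (lsharp z)) =
    lvf_hip (nablal (der x) (lsharp y)) (lsharp z) +
    lvf_hip (lsharp y) (nablal (der x) (lsharp z)).
  have [yc' zc'] := (central_dag yc, central_dag zc).
  have [c [cc -> cE]] := nabla_lsharp xc yc.
  have [d [dc -> dE]] := nabla_lsharp xc zc.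
  rewrite !lvf_hip_lsharp -[hip c z]hipS.
  have hE u v : hip u v = bil (dag u) v by rewrite /bil dagK.
  rewrite !hE (bilC c zc') (bilC d yc') cE // dE // -[star _]opprK.
  rewrite -(koszul_star nablaK) // dagK xN /christoffel tpairNr // opprK.
  by have [<-] := nablaK.
have Mb : der x (lvf_hip (lsharp y) (lsharp (z :* b))) =
    lvf_hip (nablal (der x) (lsharp y)) (lsharp (z :* b)) +
    lvf_hip (lsharp y) (nablal (der x) (lsharp (z :* b))).
  rewrite lsharpZ nabla_lvf_act // lvf_hipDr !lvf_hipZ derM // M mulrDl.
  by rewrite addrA.
rewrite [lsharp (y :* a)]lsharpZ nabla_lvf_act // lvf_hipDl !lvf_hipZl derM //.
by rewrite Mb mulrDr star_der addrA [star (der x a) * _ + _]addrC.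
Qed.

Lemma nabla_torsion del1 del2 :
  hermitian_part (DC Om) del1 -> hermitian_part (DC Om) del2 ->
  nablal del1 (phi_l Om del2) - nablal del2 (phi_l Om del1)
    - phi_l Om (lie_bracket del1 del2) = 0.
Proof.
move=> /herm_derP[x [xc _ ->]] /herm_derP[y [yc _ ->]].
rewrite der_bracket // !phi_l_der //; last exact: central_bracket.
have [c [cc -> cE]] := nabla_lsharp xc yc.
have [d [dc -> dE]] := nabla_lsharp yc xc.
apply/eqP; rewrite subr_eq0 subr_eq -lsharpD; apply/eqP; congr lsharp.
apply: bil_central_inj => z zc; rewrite !(bilC _ zc) bilDl dE // cE //.
by have [_ <- //] := nablaK; rewrite subrK.
Qed.

Lemma right_calculus :
  right_rprc (@lvf_hip R A Om) (DC Om) (@phi_l R A Om) nablal.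
Proof.
split.
- exact: lvf_hipDl.
- exact: lvf_hipDr.
- exact: lvf_hipZ.
- exact: lvf_hipS.
- move=> U U0; rewrite -[U]lflatK; apply/val_inj/funext => w.
  rewrite -[LHS]/(bil w (lflat U)) -[RHS]/(0 : A) -star0.
  rewrite -(U0 (lsharp (dag w))) lvf_hipS.
  by rewrite /lvf_hip lsharpK.
- exact: DC_lie.
- move=> _ _ /DC_derP[x xc ->] /DC_derP[y yc ->]; rewrite der_add !phi_l_der
    ?lsharpD //.
  exact: centralD.
- move=> c _ /DC_derP[x xc ->]; rewrite der_scale !phi_l_der //; last exact:
    central_scale.
  by rewrite xc lsharpZ.
- exact: phi_l_gen.
- by move=> del U V [delD _]; apply: nabla_lvfD.
- move=> _ _ U /herm_derP[x [xc _ ->]] /herm_derP[y [yc _ ->]].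
  rewrite der_add; apply/val_inj/funext => w.
  rewrite -[LHS]/(nablal _ _ w) -[RHS]/(nablal _ _ w + nablal _ _ w)
    !nabla_lvf_der //.
    by rewrite vf_pair_bilD /der bilDl opprD addrACA.
  exact: centralD.
- move=> r _ U /herm_derP[x [xc _ ->]].
  rewrite der_scale; apply/val_inj/funext => w.
  rewrite -[LHS]/(nablal _ _ w) -[RHS]/(nablal _ _ w * _) !nabla_lvf_der //.
    by rewrite vf_pair_bilZ /der bilZl -mulrBr scalar_comm.
  exact: central_scale.
- by move=> del U a [delD _]; apply: nabla_lvf_act.
- exact: real_phi_l.
- move=> del d1 d2 delH d1H d2H; have [d dH ->] := nabla_phi_l delH d1H.
  exact: real_phi_l.
- move=> del1 del2 d1 d2 del1H del2H d1H d2H.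
  have [d dH ->] := nabla_phi_l del2H d1H.
  have [d' dH' ->] := nabla_phi_l del1H dH.
  exact: real_phi_l.
- by move=> del U V; apply: nabla_metric.
- exact: nabla_torsion.
Qed.

Lemma strong_right : strongly_nondegenerate_right (@lvf_hip R A Om).
Proof.
split=> [U|f [fD fZ]].
  by split=> [V W|V a]; [exact: lvf_hipDr|exact: lvf_hipZ].
have fl : right_linear (fun w => f (lsharp w)).
  by split=> [u v|u a]; [rewrite lsharpD fD|rewrite lsharpZ fZ].
have [u [uE uU]] := hip_iso fl; exists (lsharp (dag u)); split.
  apply/funext => V; rewrite -[V]lflatK lvf_hip_lsharp.
  by rewrite -[RHS]/((fun w => f (lsharp w)) (lflat V)) -uE.
move=> V VE; rewrite -[V]lflatK -[lflat V]dagK; congr (lsharp (dag _)).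
apply: uU; apply/funext => w; rewrite dagK -VE.
by rewrite /lvf_hip lsharpK.
Qed.

(** * Conjugation of vector fields and the left calculus *)

Lemma rvf_dag_subproof (U : rvf Om) : `[< left_linear (fun w : Om => star (U
  (dag w))) >].
Proof.
have [UD UZ] := rvf_linear U; apply/asboolP; split=> [u v|a u].
  by rewrite dagD UD starD.
by rewrite dagZl UZ starM starK.
Qed.

Definition rvf_dag (U : rvf Om) : lvf Om := LVF (rvf_dag_subproof U).

Lemma rvf_dagD U V : rvf_dag (U + V) = rvf_dag U + rvf_dag V.
Proof. by apply/val_inj/funext => w; apply: starD. Qed.

Lemma rvf_dagZ a U : rvf_dag (a *: U) = rvf_dag U :* star a.
Proof. by apply/val_inj/funext => w; apply: starM. Qed.

Lemma rvf_dagN U : rvf_dag (- U) = - rvf_dag U.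
Proof. by apply/val_inj/funext => w; apply: starN. Qed.

Lemma rvf_dag_inj : injective rvf_dag.
Proof.
move=> U V UV; apply/val_inj/funext => w; apply: (can_inj starK).
by have := congr1 (fun X : lvf Om => X (dag w)) UV; rewrite /= dagK.
Qed.

Lemma rvf_dag_rsharp w : rvf_dag (rsharp w) = lsharp (dag w).
Proof. by apply/val_inj/funext => v; apply: hipS. Qed.

Lemma rvf_hip_dag U V : rvf_hip U V = lvf_hip (rvf_dag U) (rvf_dag V).
Proof.
by rewrite -{2}[U]rflatK -{2}[V]rflatK !rvf_dag_rsharp lvf_hip_lsharp.
Qed.

(** The sign is that of dag x = - x; it cancels in inner products of two such fields. *)
Lemma rvf_dag_phi del : hermitian_part (DC Om) del ->
  rvf_dag (phi_r Om del) = - phi_l Om del.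
Proof.
move=> /herm_derP[x [xc xN ->]]; rewrite phi_r_der // rvf_dag_rsharp xN
  phi_l_der //.
by apply/val_inj/funext => w; apply: bilNr.
Qed.

(** The sign in [conj_connection] is compensated by dag x = - x, so no sign remains here. *)
Lemma rvf_dag_nabla del U : hermitian_part (DC Om) del ->
  rvf_dag (nabla_rvf nabla del U) = nablal del (rvf_dag U).
Proof.
move=> /herm_derP[x [xc xN ->]]; apply/val_inj/funext => w.
rewrite -[RHS]/(nablal _ _ w) nabla_lvf_der //.
rewrite -[LHS]/(star (nabla_rvf nabla (der x) U (dag w))).
rewrite nabla_rvfE //; last exact: DC_der.
rewrite (_ : bvf_fun _ = bil x); last by apply/funext => v; apply: phi_der.
rewrite starD starN; congr (_ - _).
  by rewrite -[star (der _ _)]opprK -der_dag // xN /der bilNl opprK.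
rewrite /conj_connection; have [Ul Jl] := (rvf_linear U, lvf_linear (rvf_dag
  U)).
have [xr xl] := (bil_right_linear x, bil_left_linear xc).
elim/(@tens_ind A Om Om): (nabla (dag w)) => [|t u IHt IHu|p q].
- by rewrite tdag0 oppr0 !vf_pair0 // star0.
- by rewrite tdagD opprD !vf_pairD // starD IHt IHu.
rewrite tdagE -tenspNl !vf_pairE // starM /= dagK; congr (_ * _).
by rewrite bilNr -bilNl -xN bil_dag (bilC q xc).
Qed.

Lemma rvf_dag0 : rvf_dag 0 = 0.
Proof. by apply: (addIr (rvf_dag 0)); rewrite -rvf_dagD !add0r. Qed.

Lemma left_calculus :
  left_rprc (@rvf_hip R A Om) (DC Om) (@phi_r R A Om) (nabla_rvf nabla).
Proof.
have [cDl cDr cZ cS c0 clie _ _ cgen nDr nDl nZl nleib _ _ _ nmet ntor] :=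
  right_calculus.
have nlN del U : hermitian_part (DC Om) del -> nablal del (- U) = - nablal del
  U.
  move=> delH; have n0 : nablal del 0 = 0.
    by apply: (addIr (nablal del 0)); rewrite -nDr // !add0r.
  by apply: (addIr (nablal del U)); rewrite -nDr // !addNr.
have real0 d1 d2 : hermitian_part (DC Om) d1 -> hermitian_part (DC Om) d2 ->
    selfadjoint (rvf_hip (phi_r Om d1) (phi_r Om d2)).
  move=> /herm_derP[x [xc xN ->]] /herm_derP[y [yc yN ->]].
  rewrite !phi_r_der // /rvf_hip !rsharpK /selfadjoint hipS -!/(bil _ _).
  by rewrite xN yN !bilNr (bilC y xc).
have real_closed del d : hermitian_part (DC Om) del ->
    hermitian_part (DC Om) d -> exists2 d', hermitian_part (DC Om) d' &
      nabla_rvf nabla del (phi_r Om d) = phi_r Om d'.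
  move=> delH dH; have [d' d'H d'E] := nabla_phi_l delH dH; exists d' => //.
  by apply: rvf_dag_inj; rewrite rvf_dag_nabla // !rvf_dag_phi // nlN // d'E.
split.
- by move=> U V W; rewrite !rvf_hip_dag rvf_dagD cDl.
- by move=> U V W; rewrite !rvf_hip_dag rvf_dagD cDr.
- by move=> a U V; rewrite !rvf_hip_dag rvf_dagZ -cS cZ starM starK cS.
- by move=> U V; rewrite !rvf_hip_dag cS.
- move=> U U0; apply: rvf_dag_inj; rewrite rvf_dag0; apply: c0 => V.
  by rewrite -[V]lflatK -[lflat V]dagK -rvf_dag_rsharp -rvf_hip_dag U0.
- exact: clie.
- move=> _ _ /DC_derP[x xc ->] /DC_derP[y yc ->]; rewrite der_add !phi_r_der
    ?rsharpD //.
  exact: centralD.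
- move=> c _ /DC_derP[x xc ->]; rewrite der_scale !phi_r_der ?rsharpZ //.
  exact: central_scale.
(* The minus sign anticipates [rvf_dag_phi]; the coefficients are starred because [rvf_dag] is
   antilinear. *)
- move=> U; have [n [del [a [delH UE]]]] := cgen (- rvf_dag U).
  exists n, del, (fun i => star (a i)); split=> //; apply: rvf_dag_inj.
  rewrite (big_morph _ rvf_dagD rvf_dag0) -[LHS]opprK UE -sumrN.
  by apply: eq_bigr => i _; rewrite rvf_dagZ starK rvf_dag_phi // ractNl.
- move=> del U V delH; apply: rvf_dag_inj.
  by rewrite rvf_dagD !rvf_dag_nabla // rvf_dagD nDr.
- move=> d1 d2 U d1H d2H; apply: rvf_dag_inj.
  rewrite rvf_dagD !rvf_dag_nabla // ?nDl //.
  have [[x [xc xN d1E]] [y [yc yN d2E]]] := (herm_derP d1H, herm_derP d2H).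
  rewrite d1E d2E der_add; apply: herm_der; first exact: centralD.
  by rewrite dagD xN yN opprD.
- move=> r d U dH; apply: rvf_dag_inj.
  have rr : star ((r%:C)%:A : A) = (r%:C)%:A.
    by rewrite starZ star1 conjc_real.
  rewrite rvf_dagZ rr !rvf_dag_nabla // ?nZl //.
  have [x [xc xN dE]] := herm_derP dH.
  rewrite dE der_scale; apply: herm_der; first exact: central_scale.
  by rewrite dagZ conjc_real xN scalerN.
- move=> del a U delH; apply: rvf_dag_inj; have [_ delS] := delH.
  rewrite rvf_dagD !rvf_dagZ !rvf_dag_nabla // rvf_dagZ nleib //.
  by rewrite -[del a]delS starK.
- exact: real0.
- move=> del d1 d2 delH d1H d2H; have [d dH ->] := real_closed _ _ delH d1H.
  exact: real0.
- move=> del1 del2 d1 d2 del1H del2H d1H d2H.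
  have [d dH ->] := real_closed _ _ del2H d1H.
  have [d' dH' ->] := real_closed _ _ del1H dH.
  exact: real0.
- by move=> del U V delH; rewrite !rvf_hip_dag !rvf_dag_nabla // nmet.
- move=> del1 del2 del1H del2H; apply: rvf_dag_inj; rewrite rvf_dag0.
  (* Needed to apply [rvf_dag_phi] to the bracket; it follows from [bracket_dag] and [-x, -y] =
     [x, y]. *)
  have brH : hermitian_part (DC Om) (lie_bracket del1 del2).
    have [x [xc xN ->]] := herm_derP del1H; have [y [yc yN ->]] := herm_derP
      del2H.
    rewrite der_bracket //; apply: herm_der; first exact: central_bracket.
    have := bracket_dag xc yc; rewrite xN yN => /(congr1 -%R); rewrite opprK =>
      <-.
    congr (- _); have [xNc yNc] := (centralN xc, centralN yc).
    apply: der_inj; [exact: central_bracket|exact: central_bracket|move=> a].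
    by rewrite !der_bracketE // /der !bilNl !ddN !bilNr !opprK.
  rewrite !rvf_dagD !rvf_dagN !rvf_dag_nabla // !rvf_dag_phi // !nlN //.
  by rewrite -!opprD ntor // oppr0.
Qed.

Lemma strong_left : strongly_nondegenerate_left (@rvf_hip R A Om).
Proof.
have hE w V : rvf_hip (rsharp w) V = hip (dag w) (dag (rflat V)).
  by rewrite /rvf_hip rsharpK.
split=> [V|f [fD fZ]].
  split=> [U W|a U]; first by rewrite !rvf_hip_dag rvf_dagD lvf_hipDl.
  by rewrite !rvf_hip_dag rvf_dagZ lvf_hipZl starK.
have fl : left_linear (fun w => f (rsharp w)).
  by split=> [u v|a u]; [rewrite rsharpD fD|rewrite rsharpZ fZ].
have [v [vE vU]] := lsharp_bij (LVF (asboolT fl)).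
(* By [hE], pairing [rsharp w] with V evaluates [lsharp (dag (rflat V))] at w, so [dag (rflat V)]
   must be v. *)
exists (rsharp (dag v)); split.
  apply/funext => U; rewrite -[U]rflatK hE rsharpK dagK.
  exact: (congr1 (fun X : lvf Om => X (rflat U)) vE).
move=> V VE; rewrite -[V]rflatK; congr rsharp; rewrite -[RHS]dagK; congr dag.
by apply: vU; apply/val_inj/funext => w; rewrite /= -VE hE.
Qed.

End Induced.

End Centred.

Unset Implicit Arguments.

Theorem corollary4p25 (R : realType) (A : starAlgType R)
    (Om : centredCalculus A) :
  (exists! nabla : Om -> T2 Om, levi_civita nabla) /\
  forall nabla : Om -> T2 Om, levi_civita nabla ->
    [/\ right_rprc (@lvf_hip R A Om) (DC Om) (@phi_l R A Om)
          (nabla_lvf (conj_connection nabla)),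
        left_rprc (@rvf_hip R A Om) (DC Om) (@phi_r R A Om)
          (nabla_rvf nabla),
        strongly_nondegenerate_right (@lvf_hip R A Om)
      & strongly_nondegenerate_left (@rvf_hip R A Om)].
Proof.
split=> [|nabla nablaL].
  have [nabla nablaL] := levi_civita_exists Om.
  by exists nabla; split=> // nabla'; apply: levi_civita_unique.
split.
- exact: right_calculus.
- exact: left_calculus.
- exact: strong_right.
- exact: strong_left.
Qed.
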